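(* Let $d\ge 2$ be an integer and let $Q\in l_1(\mathbb{Z})$ be a strictly positive even function (transfer operator) with $Q(0)=1$. 1. If $(\Vert Q\Vert_{1,\mathbb{Z}},\Vert Q\Vert_{1,\mathbb{Z}\setminus\{0\}})\in G_d$, then for every integer $q\ge 2$ there exist tree-automorphism invariant gradient Gibbs measures for $Q$ of the form $\nu^{\lambda_q}$, with $\lambda_q$ a $q$-periodic boundary law for $Q$, which are not equal to the free state. 2. Set $\tilde Q(i):=\sup_{|j|\ge|i|}Q(j)$ for $i\in\mathbb{Z}$, and assume that $$\sum_{i=1}^\infty\Big(\sum_{j=1}^\infty\tilde Q(ij)\Big)^{\frac{d+1}{2}}<\infty.$$ If $(\Vert Q\Vert_{\frac{d+1}{2},\mathbb{Z}},\Vert Q\Vert_{d+1,\mathbb{Z}\setminus\{0\}})\in G_d^{o}$ (the interior of $G_d$), then there exists $q_0=q_0(Q,d)$ such that for all $q\ge q_0$ there exist tree-automorphism invariant gradient Gibbs measures for $Q$ of the form $\nu^{\lambda_q}$, with $\lambda_q$ a $q$-periodic boundary law for $Q$, which are not equal to the free state.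
   Context: The Cayley tree $\Gamma^d=(V,L)$ of order $d$ is the infinite connected graph without cycles in which every vertex has exactly $d+1$ neighbours; $\vec L$ denotes the set of oriented edges $(x,y)$. Norms: $\Vert x\Vert_{p,S}=\big(\sum_{j\in S}|x(j)|^p\big)^{1/p}$. Good set: $G_d:=\{(\gamma,\delta)\in(1,\infty)\times(0,\infty)\mid\exists\,\varepsilon>0:\ \delta+\gamma\varepsilon^d\le\varepsilon\ \text{ and }\ 2d\gamma\varepsilon^{d-1}+2d\delta\varepsilon^d<1\}$. Periodic boundary laws. A (spatially homogeneous) $q$-periodic boundary law for $Q$ is a $q$-periodic function $\lambda_q:\mathbb{Z}\to(0,\infty)$ for which there is $c>0$ with $\lambda_q(i)=c\big(\sum_{j\in\mathbb{Z}}Q(i-j)\lambda_q(j)\big)^d$ for all $i\in\mathbb{Z}$. It is identified with a function on $\mathbb{Z}_q=\mathbb{Z}/q\mathbb{Z}$. Put $Q_q(\bar s)=\sum_{l\in\bar s}Q(l)$ for $\bar s\in\mathbb{Z}_q$. The measure $\nu^{\lambda_q}$. Gradient configurations are $\zeta\in\mathbb{Z}^{\vec L}$ with $\zeta_{(x,y)}=-\zeta_{(y,x)}$; a height configuration $\omega\in\mathbb{Z}^V$ induces $(\nabla\omega)_{(x,y)}=\omega_y-\omega_x$. Let $P'_q(\bar i,\bar j)=\frac{Q_q(\bar i-\bar j)\lambda_q(\bar j)}{\sum_{\bar s\in\mathbb{Z}_q}Q_q(\bar i-\bar s)\lambda_q(\bar s)}$, a transition matrix on $\mathbb{Z}_q$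 with reversible stationary distribution $\alpha(\bar i)=\lambda_q(\bar i)^{\frac{d+1}{d}}/\sum_{\bar j\in\mathbb{Z}_q}\lambda_q(\bar j)^{\frac{d+1}{d}}$. Let $P^{\lambda_q,\mathrm{f.c.}}$ be the law on $\mathbb{Z}_q^V$ of the stationary tree-indexed Markov chain $\sigma'$ (the fuzzy chain): for finite connected $\Lambda\ni w$, $P^{\lambda_q,\mathrm{f.c.}}(\sigma'_\Lambda)=\alpha(\sigma'_w)\prod P'_q(\sigma'_x,\sigma'_y)$, the product over edges $(x,y)$ in $\Lambda$ oriented away from $w$. Let $\rho^Q_q(j\mid\bar s)=\mathbf 1(j\in\bar s)\,Q(j)/Q_q(\bar s)$. Then $\nu^{\lambda_q}$ is the probability measure on gradient configurations $\eta$ with marginals, for finite connected $\Lambda\subset V$, $$\nu^{\lambda_q}(\eta_\Lambda=\zeta_\Lambda)=\sum_{\sigma'_\Lambda\in\mathbb{Z}_q^\Lambda}P^{\lambda_q,\mathrm{f.c.}}(\sigma'_\Lambda)\prod_{(x,y)}\rho^Q_q(\zeta_{(x,y)}\mid\sigma'_y-\sigma'_x),$$ the product over the edges inside $\Lambda$, each taken in one orientation. Gradient Gibbs measure for $Q$: a probability measure $\nu$ on gradient configurations such that for every finite $\Lambda\subset V$, conditionally on all height differences between vertices of $V\setminus\Lambda$, the gradient field is distributed as $\nabla\sigma$ with $\sigma\sim\gamma_\Lambda(\cdot\mid\omega)$, where $\omega$ is any height configuration with those height differences outside $\Lambda$ and $\gamma_\Lambda(\sigma_\Lambda=\omega_\Lambda\mid\omega)\propto\prod_{\{x,y\}\in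 L,\,\{x,y\}\cap\Lambda\neq\emptyset}Q(\omega_x-\omega_y)$. Free state: the measure on gradient configurations under which the increments along the edges (one orientation per edge) are i.i.d. with distribution $Q/\Vert Q\Vert_{1,\mathbb{Z}}$. *)

(* Defs.v *)
From HB Require Import structures.
From mathcomp Require Import all_boot all_order all_algebra finmap.
From mathcomp Require Import boolp classical_sets functions cardinality fsbigop.
From mathcomp Require Import reals ereal topology normedtype sequences esum exp.
From mathcomp Require Import measure lebesgue_measure lebesgue_integral.

Set Implicit Arguments.
Unset Strict Implicit.
Unset Printing Implicit Defensive.

Import Order.TTheory GRing.Theory Num.Theory.
Import numFieldNormedType.Exports.

Local Open Scope classical_set_scope.
Local Open Scope ring_scope.

(* Sum of a nonnegative family.  It is only applied to families which are
   summable whenever Q is in l_1 (a divergent sum would be read as 0). *)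
Definition rsum (R : realType) (T : choiceType) (S : set T) (f : T -> R) : R :=
  fine (\esum_(i in S) (f i)%:E).

Definition lp_norm (R : realType) (p : R) (S : set int) (Q : int -> R) : R :=
  rsum S (fun j => `|Q j| `^ p) `^ p^-1.

Definition good_set (R : realType) (d : nat) : set (R * R) :=
  [set gd | [/\ 1 < gd.1, 0 < gd.2 &
    exists eps : R, [/\ 0 < eps,
      gd.2 + gd.1 * eps ^+ d <= eps &
      d.*2%:R * gd.1 * eps ^+ d.-1 + d.*2%:R * gd.2 * eps ^+ d < 1]]].

Definition radial_sup (R : realType) (Q : int -> R) (i : int) : R :=
  sup [set Q j | j in [set j : int | `|i| <= `|j|]].

Section Graph.
Variables (V : countType) (e : rel V).

(* A duplicate-free closed walk of length 2 runs back and forth along one edge;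
   cycles of the graph are those of length at least 3. *)
Definition cayley_tree (d : nat) : Prop :=
  [/\ symmetric e /\ irreflexive e,
      infinite_set [set: V],
      forall x y, exists2 p, path.path e x p & last x p = y,
      forall c : seq V, path.cycle e c -> uniq c -> (size c <= 2)%N &
      forall x, ([set y | e x y] #= `I_d.+1)%card].

(* Every unordered edge in exactly one of its two orientations, selected by the
   enumeration of V.  All products taken along this orientation have factors
   that are symmetric under reversal, Q being even. *)
Definition edge1 (x y : V) : bool := e x y && (choice.pickle x < choice.pickle y)%N.

Definition away (w x y : V) : bool :=
  `[< exists p, [/\ path.path e w (rcons p y), uniq (w :: rcons p y) &
                    last w p = x] >].

Definition connected_fset (L : {fset V}) : Prop :=
  forall x y, x \in L -> y \in L ->
    exists p, [/\ path.path e x p, {subset p <= L} & last x p = y].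

Definition automorphism (phi : V -> V) : Prop :=
  bijective phi /\ {mono phi : x y / e x y}.

(* An antisymmetric function on oriented edges, extended by 0 to the pairs of
   vertices that are not edges. *)
Record gradient : Type := Gradient {
  gval :> V -> V -> int ;
  gradient_anti : forall x y, gval x y = - gval y x ;
  gradient_off : forall x y, ~~ e x y -> gval x y = 0 }.

HB.instance Definition _ := gen_eqMixin gradient.
HB.instance Definition _ := gen_choiceMixin gradient.

Definition gradient0 : gradient :=
  @Gradient (fun _ _ => 0) (fun _ _ => esym (oppr0 _)) (fun _ _ _ => erefl).

HB.instance Definition _ := isPointed.Build gradient gradient0.

Definition cylinders : set (set gradient) :=
  [set A | exists x y k, A = [set eta : gradient | eta x y = k]].

Definition gradient_of (omega : V -> int) (eta : gradient) : Prop :=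
  forall x y, e x y -> eta x y = omega y - omega x.

Lemma relabel_anti (phi : V -> V) (eta : gradient) (x y : V) :
  eta (phi x) (phi y) = - eta (phi y) (phi x).
Proof. exact: gradient_anti. Qed.

Lemma relabel_off (phi : V -> V) (aut : automorphism phi) (eta : gradient)
  (x y : V) : ~~ e x y -> eta (phi x) (phi y) = 0.
Proof. by move=> nexy; apply: gradient_off; rewrite (proj2 aut). Qed.

Definition relabel (phi : V -> V) (aut : automorphism phi) (eta : gradient) :
    gradient :=
  @Gradient (fun x y => eta (phi x) (phi y)) (relabel_anti phi eta)
    (relabel_off aut eta).

(* The sigma-algebra <<s outer_events L >> is generated by the height
   differences between vertices of the complement of L; these are not in
   general determined by the increments along the edges outside L. *)
Definition outer_events (L : {fset V}) : set (set gradient) :=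
  [set A | exists x y k, [/\ x \notin L, y \notin L &
    A = [set eta | exists2 omega, gradient_of omega eta &
                                  omega y - omega x = k]]].

Definition same_outer_differences (L : {fset V}) (eta : gradient)
    (omega : V -> int) : Prop :=
  exists2 omega', gradient_of omega' eta &
    forall x y, x \notin L -> y \notin L ->
      omega y - omega x = omega' y - omega' x.

End Graph.

Arguments cylinders {V} e _.
Arguments outer_events {V} e L _.

Notation grad_space e := (g_sigma_algebraType (cylinders e)).

Section BoundaryLaw.
Variables (R : realType) (d : nat) (Q : int -> R) (q : nat).

Definition periodic_boundary_law (lam : int -> R) : Prop :=
  [/\ forall i, 0 < lam i,
      forall i, lam (i + q%:Z) = lam i &
      exists2 c : R, 0 < c &
        forall i, lam i = c * rsum [set: int] (fun j => Q (i - j) * lam j) ^+ d].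

Definition Qq (s : 'Z_q) : R := rsum [set l : int | l%:~R = s] Q.

(* The function on Z/qZ induced by a q-periodic function (1 < q), read off at
   the representative in {0, ..., q-1}. *)
Definition on_Zq (lam : int -> R) (s : 'Z_q) : R := lam (Posz (val s)).

Definition fuzzy_P (lam : int -> R) (i j : 'Z_q) : R :=
  Qq (i - j) * on_Zq lam j / \sum_(s : 'Z_q) Qq (i - s) * on_Zq lam s.

Definition fuzzy_alpha (lam : int -> R) (i : 'Z_q) : R :=
  on_Zq lam i `^ (d.+1%:R / d%:R)
  / \sum_(j : 'Z_q) on_Zq lam j `^ (d.+1%:R / d%:R).

Definition rho (j : int) (s : 'Z_q) : R :=
  if j%:~R == s then Q j / Qq s else 0.

Variables (V : countType) (e : rel V).

(* Probability that the stationary fuzzy chain equals s on L, written with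
   root w in L. *)
Definition fuzzy_chain (lam : int -> R) (L : {fset V}) (w : L)
    (s : {ffun L -> 'Z_q}) : R :=
  fuzzy_alpha lam (s w)
  * \prod_(p : L * L | away e (val w) (val p.1) (val p.2))
      fuzzy_P lam (s p.1) (s p.2).

Definition is_nu (lam : int -> R) (nu : probability (grad_space e) R) : Prop :=
  forall (L : {fset V}) (w : L) (zeta : gradient e), connected_fset e L ->
    nu [set eta : gradient e | forall x y, x \in L -> y \in L ->
                                 eta x y = zeta x y]
    = (\sum_(s : {ffun L -> 'Z_q})
         fuzzy_chain lam w s
         * \prod_(p : L * L | edge1 e (val p.1) (val p.2))
             rho (zeta (val p.1) (val p.2)) (s p.2 - s p.1))%:E.

End BoundaryLaw.

Section GradientMeasures.
Variables (R : realType) (Q : int -> R) (V : countType) (e : rel V).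

Definition gibbs_weight (L : {fset V}) (omega : V -> int) : R :=
  \big[*%R/1]_(p \in [set p : V * V | edge1 e p.1 p.2 /\
                                      (p.1 \in L) || (p.2 \in L)])
    Q (omega p.1 - omega p.2).

(* The probability, under the Gibbs kernel in L with boundary condition omega,
   that the gradient of the height configuration lies in A. *)
Definition gibbs_kernel (L : {fset V}) (omega : V -> int)
    (A : set (gradient e)) : R :=
  let ext := [set sigma : V -> int |
               forall x, x \notin L -> sigma x = omega x] in
  rsum (ext `&` [set sigma | exists2 eta, A eta & gradient_of sigma eta])
    (gibbs_weight L)
  / rsum ext (gibbs_weight L).

(* g is a version of nu(A | <<s F >>). *)
Definition cond_prob (nu : probability (grad_space e) R)
    (F : set (set (gradient e))) (A : set (gradient e))
    (g : gradient e -> R) : Prop :=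
  (forall B : set R, measurable B -> <<s F >> (g @^-1` B)) /\
  (forall B : set (gradient e), <<s F >> B ->
     (\int[nu]_(eta in (B : set (grad_space e))) (g eta)%:E = nu (A `&` B))%E).

Definition gradient_gibbs (nu : probability (grad_space e) R) : Prop :=
  forall (L : {fset V}) (A : set (grad_space e)), measurable A ->
    exists2 g : gradient e -> R,
      forall eta omega, same_outer_differences L eta omega ->
        g eta = gibbs_kernel L omega A &
      cond_prob nu (outer_events e L) A g.

Definition aut_invariant (nu : probability (grad_space e) R) : Prop :=
  forall (phi : V -> V) (aut : automorphism e phi) (A : set (grad_space e)),
    measurable A -> nu (relabel aut @^-1` A) = nu A.

Definition is_free_state (nu : probability (grad_space e) R) : Prop :=
  forall (D : {fset V * V}) (k : V * V -> int),
    (forall p, p \in D -> edge1 e p.1 p.2) ->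
    nu [set eta : gradient e | forall p, p \in D -> eta p.1 p.2 = k p]
    = (\prod_(p <- D) (Q (k p) / lp_norm 1 [set: int] Q))%:E.

End GradientMeasures.

(* Main.v *)
(* Write the boundary law as lam = U^d with U > 0 on Z/qZ; the boundary law
   equation becomes sum_t Q_q(s - t) U(t)^d = K U(s), the critical point equation
   of  (sum_{s,t} Q_q(s - t) U(s)^d U(t)^d)^(d+1) / (sum_s U(s)^(d+1))^(2d).
   A maximizer exists by compactness and is strictly positive.  It is not constant
   as soon as the indicator of 0 beats the constants, which happens when
   ||Q||_1^(d+1) < q^(d-1).  In the first part this bound (even with q = 2)
   follows from the definition of the good set by elementary estimates; in the
   second part it holds for every large q, because Q is summable.

   In terms of U, the probability that the increments on a finite connected set L
   are those of a height function w is proportional to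
     K^(-|L|) prod_{edges xy of L} Q(w_x - w_y)
       sum_s prod_{x in L} U(s + w_x)^(number of neighbours of x outside L).
   This expression does not single out a root, which makes invariance under
   automorphisms evident, and summing over the height at a leaf uses exactly the
   equation for U.  The vertices are enumerated so that initial segments are
   connected, and the measure is the image of Lebesgue measure on [0,1[ under nested
   partitions into intervals with these lengths.  If L contains a finite
   set and all its neighbours, the factors U disappear inside that set: this is the
   Gibbs property.  Finally, for the free state the marginal on one edge would give
   sum_s U(s)^d U(s+1)^d = sum_s U(s)^(2d), which forces U to be constant. *)
Require Import Defs.
From HB Require Import structures.
From mathcomp Require Import all_boot all_order all_algebra finmap.
From mathcomp Require Import boolp classical_sets functions cardinality fsbigop.
From mathcomp Require Import reals ereal topology normedtype sequences esum exp.
From mathcomp Require Import measure lebesgue_measure lebesgue_integral.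
From mathcomp Require Import numfun measurable_realfun derive realfun ring lra.

Set Implicit Arguments.
Unset Strict Implicit.
Unset Printing Implicit Defensive.

Import Order.TTheory GRing.Theory Num.Theory.
Import numFieldNormedType.Exports.

Local Open Scope classical_set_scope.
Local Open Scope ring_scope.

(** * The numerical bound given by the good set *)

(** Both powers in the quotient have degree [2 d (d + 1)], so it is scale invariant and can be
    maximized on a simplex. With [S] the l_1 norm of [Q], constants have the value
    [S ^ (d + 1) / q ^ (d - 1)], while the indicator of 0 has at least [Q 0 ^ (d + 1) = 1]; this is
    the origin of the criterion. A coordinate cannot vanish at a maximum: raising it to [x] gains
    order [x ^ d] in the numerator and costs only order [x ^ (d + 1)] in the denominator. Since
    [Q 0 = 1], the two norms of the first part satisfy [gam = 1 + del], and the first condition of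
    the good set becomes [gam (1 + eps ^ d) <= 1 + eps]. The Gibbs property conditions on height
    differences between all vertices off [L], also between different components, which the
    increments there do not determine. Acyclicity lets every gradient be integrated from a root, so
    events and kernels are expressed by a normalised height function, and only quantities invariant
    under a global shift matter. *)

Section NumericBound.
Context {R : realFieldType}.
Implicit Types (x gam eps : R) (d m n : nat).

Lemma bernoulli x n : 0 <= x -> 1 + n%:R * x <= (1 + x) ^+ n.
Proof.
move=> x0; elim: n => [|n IH]; first by rewrite mul0r addr0.
rewrite exprS; apply: le_trans (_ : (1 + x) * (1 + n%:R * x) <= _).
  have : 0 <= n%:R * x ^+ 2 by rewrite mulr_ge0 ?exprn_ge0.
  by rewrite -natr1; lra.
by rewrite ler_pM2l // ltr_pwDl.
Qed.

(** Four terms are kept because at [x = 3 / (2 m + 3)] and exponent [m + 2] they tend to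
    [1 + 3/2 + 9/8 + 9/16 > 4], whereas the first three alone drop below 4 for large [m]. *)
Lemma binomial_lower_bound x n : 0 <= x ->
  1 + n%:R * x + 'C(n, 2)%:R * x ^+ 2 + 'C(n, 3)%:R * x ^+ 3 <= (1 + x) ^+ n.
Proof.
move=> x0; elim: n => [|n IH]; first by rewrite !bin0n /=; lra.
rewrite [leRHS]exprS !binS bin1 !natrD -natr1.
apply: (@le_trans _ _ ((1 + x) * (1 + n%:R * x + 'C(n, 2)%:R * x ^+ 2 +
  'C(n, 3)%:R * x ^+ 3))); last by rewrite ler_wpM2l //; lra.
have : 0 <= 'C(n, 3)%:R * x ^+ 4 by rewrite mulr_ge0 ?exprn_ge0.
lra.
Qed.

Lemma bin2_ring n : 'C(n, 2)%:R = n%:R * (n%:R - 1) / 2 :> R.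
Proof.
elim: n => [|n IH]; first by rewrite bin0n /=; lra.
by rewrite binS bin1 natrD IH -natr1; field.
Qed.

Lemma bin3_ring n : 'C(n, 3)%:R = n%:R * (n%:R - 1) * (n%:R - 2) / 6 :> R.
Proof.
elim: n => [|n IH]; first by rewrite bin0n /=; lra.
by rewrite binS natrD bin2_ring IH -natr1; field.
Qed.

(* With [d = m + 1], the ratio [r = (2 m + 3) / (m + 3)] separates the two
   conditions: [r ^ (d + 1) <= 2 ^ (d - 1)], while [gam >= r] would force
   [eps >= r - 1] and contradict [2 d gam eps ^ (d - 1) < 1]. *)
Lemma threshold_pow_le m :
  ((2 * m%:R + 3) / (m%:R + 3)) ^+ m.+2 <= 2 ^+ m :> R.
Proof.
set r := _ / _; have m0 : 0 <= m%:R :> R by [].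
have r0 : 0 < r by rewrite divr_gt0 //; lra.
(* Chosen so that [r (1 + x) = 2]; multiplying by [(1 + x) ^ (m + 2)] then leaves
   [4 <= (1 + x) ^ (m + 2)]. *)
set x : R := 3 / (2 * m%:R + 3).
have x0 : 0 <= x by rewrite divr_ge0 //; lra.
have rx : r * (1 + x) = 2 by rewrite /r /x; field; apply/andP; split; lra.
suff h : 4 <= (1 + x) ^+ m.+2.
  rewrite -(ler_pM2r (_ : 0 < (1 + x) ^+ m.+2)); last first.
    by rewrite exprn_gt0 //; lra.
  rewrite -exprMn rx exprS exprS.
  have -> : 2 * (2 * 2 ^+ m) = 2 ^+ m * 4 :> R by ring.
  by rewrite ler_pM2l ?exprn_gt0.
apply: le_trans (binomial_lower_bound _ x0).
rewrite bin2_ring bin3_ring -natr1 -natr1 /x.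
rewrite -subr_ge0.
set y : R := m%:R in m0 *.
rewrite [leRHS](_ : _ =
  (3 / 2 * y ^+ 3 + 6 * y ^+ 2 + 9 / 2 * y) / (2 * y + 3) ^+ 3); last by field; lra.
by rewrite divr_ge0 ?exprn_ge0 ?addr_ge0 ?mulr_ge0 ?exprn_ge0 //; lra.
Qed.

(** Inverting the power, [((m + 3) / m) ^ m] stays bounded while the other side grows linearly; the
    proof is an induction on [m]. *)
Lemma threshold_pow_ge m : (0 < m)%N ->
  1 <= 2 * (m%:R + 1) * ((2 * m%:R + 3) / (m%:R + 3)) *
       (m%:R / (m%:R + 3)) ^+ m :> R.
Proof.
move=> m_gt0.
suff h : ((m%:R + 3) / m%:R) ^+ m <=
         2 * (m%:R + 1) * ((2 * m%:R + 3) / (m%:R + 3)) :> R.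
  have m0 : 0 < m%:R :> R by rewrite ltr0n.
  rewrite -[m%:R / (m%:R + 3)]invf_div exprVn ler_pdivlMr ?mul1r //.
  by rewrite exprn_gt0 // divr_gt0 //; lra.
case: m m_gt0 => // m _; elim: m => [|m IH].
  by rewrite -subr_ge0 [leRHS](_ : _ = 1) //; field.
(* The value 2 is checked directly as well: the induction step from [y] to [y + 1] ends with a
   factor [y - 2], so it needs [y >= 2]. *)
have [->|m0] := posnP m.
  by rewrite -subr_ge0 [leRHS](_ : _ = 43 / 20) //; field.
set y : R := m.+1%:R in IH *.
have y2 : 2 <= y by rewrite /y ler_nat.
have -> : m.+2%:R = y + 1 :> R by rewrite natr1.
set x : R := 3 / ((y + 1) * (y + 3)).
have x0 : 0 <= x by rewrite divr_ge0 // mulr_ge0; lra.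
have x1 : x <= 1 by rewrite ler_pdivrMr ?mulr_gt0 //; nra.
have -> : (y + 1 + 3) / (y + 1) = (1 - x) * ((y + 3) / y).
  by rewrite /x; field; apply/and3P; split; lra.
rewrite exprS exprMn.
(* Bernoulli bounds [(1 + x) ^ y] from below, and [(1 - x) (1 + x) <= 1] turns this into an upper
   bound for [(1 - x) ^ y]. *)
have hx : (1 - x) ^+ m.+1 <= (1 + y * x)^-1.
  have yx : 0 < 1 + y * x by rewrite ltr_pwDl // mulr_ge0; lra.
  rewrite -[leRHS]div1r ler_pdivlMr //.
  apply: le_trans (_ : (1 - x) ^+ m.+1 * (1 + x) ^+ m.+1 <= _).
    by rewrite ler_wpM2l ?exprn_ge0 ?subr_ge0 // bernoulli.
  rewrite -exprMn exprn_ile1 //; nra.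
apply: le_trans (_ : (1 - x) * ((y + 3) / y) * ((1 + y * x)^-1 *
    (2 * (y + 1) * ((2 * y + 3) / (y + 3)))) <= _).
  have y0 : 0 <= y by [].
  rewrite ler_wpM2l ?mulr_ge0 ?subr_ge0 ?divr_ge0 ?invr_ge0 ?addr_ge0 //.
  rewrite ler_pM //; first by rewrite exprn_ge0 // subr_ge0.
  by rewrite exprn_ge0 // divr_ge0; lra.
rewrite -subr_ge0 [leRHS](_ : _ = (y - 2) * (4 * y ^+ 2 + 16 * y + 18) /
  ((y + 4) * (y ^+ 2 + 7 * y + 3))); last first.
  rewrite /x; field; rewrite !gt_eqF //=; nra.
by apply: divr_ge0; apply: mulr_ge0; nra.
Qed.

Lemma good_set_pow_bound m gam eps : (0 < m)%N ->
  1 < gam -> 0 < eps -> gam * (1 + eps ^+ m.+1) <= 1 + eps ->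
  2 * (m%:R + 1) * gam * eps ^+ m < 1 -> gam ^+ m.+2 < 2 ^+ m.
Proof.
move=> m0 gam1 eps0 hge hlt; rewrite ltNge; apply/negP => hpow.
have ym : 0 < m%:R :> R by rewrite ltr0n.
set r : R := (2 * m%:R + 3) / (m%:R + 3).
have r0 : 0 < r by rewrite divr_gt0 //; lra.
have rgam : r <= gam.
  rewrite -(@ler_pXn2r _ m.+2) ?nnegrE //; [|lra|lra].
  exact: le_trans (threshold_pow_le m) hpow.
have epse : 0 < eps ^+ m.+1 by rewrite exprn_gt0.
have reps : m%:R / (m%:R + 3) <= eps.
  have -> : m%:R / (m%:R + 3) = r - 1 by rewrite /r; field; lra.
  nra.
have := threshold_pow_ge m0; rewrite leNgt => /negP; apply.
apply: le_lt_trans hlt; apply: ler_pM.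
- by rewrite !mulr_ge0 //; lra.
- by rewrite exprn_ge0 // divr_ge0 //; lra.
- by rewrite ler_wpM2l //; lra.
- by rewrite lerXn2r // nnegrE ?divr_ge0 //; lra.
Qed.

End NumericBound.

(** * Existence of a non-constant boundary law *)

Section StationaryPoint.
Context {R : realType}.
Implicit Types (a b c s t g x : R) (d m n : nat) (p : {poly R}).

Lemma deriv_interior_max p x : 0 < x ->
  (forall y, 0 <= y -> p.[y] <= p.[x]) -> p^`().[x] = 0.
Proof.
move=> x0 hmax.
have xin : x \in `]0, x + 1[%R by rewrite in_itv /= x0 ltrDl ltr01.
have := @derive1_at_max R (horner p) 0 (x + 1) x.
have -> : 0 <= x + 1 by rewrite addr_ge0 // ltW.
move=> /(_ isT (fun t _ => @derivable_horner _ p t) xin) [].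
  by move=> t; rewrite in_itv /= => /andP[/ltW t0 _]; exact: hmax.
by move=> _ <-; rewrite derivE derive1E.
Qed.

(** Chord bound from convexity on [[0, 1]], with slope [2 ^ n - 1] rounded up. It limits the loss in
    the denominator when a zero coordinate is raised; the tangent bound that follows secures the
    gain in the numerator. *)
Lemma exprD1_le x n : 0 <= x -> x <= 1 -> (1 + x) ^+ n <= 1 + 2 ^+ n * x.
Proof.
move=> x0 x1; apply: le_trans (_ : 1 + (2 ^+ n - 1) * x <= _); last by lra.
elim: n => [|n IH]; first by rewrite !expr0; lra.
have e1 : 0 <= (2 ^+ n - 1) * x * (1 - x).
  by rewrite !mulr_ge0 ?subr_ge0 // exprn_ege1 // ler1n.
rewrite exprS; apply: le_trans (_ : (1 + x) * (1 + (2 ^+ n - 1) * x) <= _).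
  by rewrite ler_wpM2l //; lra.
by rewrite exprS; lra.
Qed.

Lemma exprD_le x t n : 0 <= x -> 0 <= t ->
  x ^+ n.+1 + n.+1%:R * x ^+ n * t <= (x + t) ^+ n.+1.
Proof.
move=> x0 t0; elim: n => [|n IH]; first by rewrite !expr1 expr0 mulr1 mul1r.
rewrite [leRHS]exprS; apply: le_trans (_ : (x + t) *
   (x ^+ n.+1 + n.+1%:R * x ^+ n * t) <= _); last first.
  by rewrite ler_wpM2l // addr_ge0.
have : 0 <= n.+1%:R * x ^+ n * t ^+ 2 by rewrite !mulr_ge0 ?exprn_ge0.
rewrite -[n.+2%:R]natr1 !exprS; nra.
Qed.

(* The hypothesis [hmax] says that [x0] maximizes over [x >= 0] the quotient
   [(b x^2d + 2 a x^d + c)^(d+1) / (x^(d+1) + s)^2d]. *)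
Lemma quotient_maximizer d a b c s g t x0 : (0 < d)%N ->
  0 < a -> 0 <= b -> 0 <= c -> 0 <= s -> 0 <= x0 ->
  g = b * x0 ^+ (2 * d) + 2 * a * x0 ^+ d + c -> 0 < g ->
  t = x0 ^+ d.+1 + s -> 0 < t ->
  (forall x, 0 <= x ->
     (b * x ^+ (2 * d) + 2 * a * x ^+ d + c) ^+ d.+1 * t ^+ (2 * d) <=
     g ^+ d.+1 * (x ^+ d.+1 + s) ^+ (2 * d)) ->
  0 < x0 /\ b * x0 ^+ d + a = g / t * x0.
Proof.
move=> d0 a0 b0 c0 s0 x00 gE g0 tE t0 hmax.
have x0_gt0 : 0 < x0.
  rewrite lt_neqAle x00 andbT; apply/eqP => x0E.
  have {gE} gE : g = c.
    by rewrite gE -x0E !expr0n muln_eq0 (gtn_eqF d0) /= !mulr0 !add0r.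
  have {tE} tE : t = s by rewrite tE -x0E expr0n /= add0r.
  subst t g.
  (* If [x0 = 0], maximality compares a gain linear in [x ^ d] with a loss linear in [x ^ (d + 1)];
     dividing by [c ^ d x ^ d] leaves an inequality that fails for small [x]. *)
  have key x : 0 < x -> x ^+ d.+1 <= s ->
      d.+1%:R * (2 * a) <= c * (2 ^+ (2 * d) / s) * x.
    move=> xp xs; have := hmax _ (ltW xp).
    set Y := x ^+ d.+1; have Y0 : 0 <= Y by rewrite exprn_ge0 // ltW.
    have -> : Y + s = s * (1 + Y / s) by field; rewrite gt_eqF.
    rewrite exprMn mulrCA mulrC ler_pM2l ?exprn_gt0 // => h1.
    have h2 : c ^+ d.+1 + d.+1%:R * c ^+ d * (2 * a * x ^+ d) <=
       c ^+ d.+1 * (1 + 2 ^+ (2 * d) * (Y / s)).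
      apply: le_trans (_ : c ^+ d.+1 * (1 + Y / s) ^+ (2 * d) <= _); last first.
        rewrite ler_wpM2l ?exprn_ge0 ?exprD1_le ?divr_ge0 //.
        by rewrite ler_pdivrMr // mul1r.
      apply: le_trans h1.
      apply: le_trans (exprD_le _ _ _) _ => //.
        by rewrite !mulr_ge0 ?exprn_ge0 // ltW.
      rewrite lerXn2r ?nnegrE ?addr_ge0 ?mulr_ge0 ?exprn_ge0 ?(ltW a0) ?(ltW xp) //.
      by rewrite [leRHS]addrC lerD2l lerDr mulr_ge0 // exprn_ge0 // ltW.
    have cd : 0 < c ^+ d * x ^+ d by rewrite mulr_gt0 ?exprn_gt0.
    rewrite -(ler_pM2l cd).
    move: h2; rewrite mulrDr mulr1 lerD2l /Y !exprS => h2.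
    apply: le_trans (le_trans h2 _); rewrite le_eqVlt; apply/orP; left; apply/eqP; ring.
  set D := d.+1%:R * (2 * a) in key.
  set E := c * (2 ^+ (2 * d) / s) in key.
  have D0 : 0 < D by rewrite mulr_gt0 ?ltr0n // mulr_gt0.
  have E0 : 0 < E by rewrite mulr_gt0 // divr_gt0 // exprn_gt0.
  (* Below 1 and [s], so that [x ^ (d + 1) <= s]; below half of [D / E], so that [D <= E x] is
     violated. *)
  pose x := Num.min (Num.min 1 s) (D / E / 2).
  have x1 : x <= 1 by rewrite /x !ge_min lexx.
  have xs : x <= s by rewrite /x !ge_min lexx orbT.
  have xD : x <= D / E / 2 by rewrite /x ge_min lexx orbT.
  have xp : 0 < x by rewrite /x !lt_min ltr01 t0 !divr_gt0.
  have xds : x ^+ d.+1 <= s.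
    by apply: le_trans xs; rewrite exprS ler_piMr ?(ltW xp) // exprn_ile1 // ltW.
  have := key x xp xds; apply/negP; rewrite -ltNge.
  apply: le_lt_trans (_ : E * (D / E / 2) < D); first by rewrite ler_wpM2l // ltW.
  have -> : E * (D / E / 2) = D / 2 by field; rewrite gt_eqF.
  by lra.
split=> //.
pose P : {poly R} := b *: 'X^(2 * d) + (2 * a) *: 'X^d + c%:P.
pose S : {poly R} := 'X^(d.+1) + s%:P.
(* The cross-multiplied difference is a polynomial that is nonpositive on [x >= 0] and vanishes at
   [x0], so its derivative vanishes there. *)
pose F := t ^+ (2 * d) *: P ^+ d.+1 - g ^+ d.+1 *: S ^+ (2 * d).
have PE x : P.[x] = b * x ^+ (2 * d) + 2 * a * x ^+ d + c by rewrite /P !hornerE.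
have SE x : S.[x] = x ^+ d.+1 + s by rewrite /S !hornerE.
have FE x : F.[x] = P.[x] ^+ d.+1 * t ^+ (2 * d) - g ^+ d.+1 * S.[x] ^+ (2 * d).
  by rewrite /F !hornerE [X in X - _]mulrC.
have F0 : F.[x0] = 0 by rewrite FE PE SE -gE -tE subrr.
have := @deriv_interior_max F x0 x0_gt0.
have hF y : 0 <= y -> F.[y] <= F.[x0].
  by move=> y0; rewrite F0 FE PE SE subr_le0; exact: hmax.
move=> /(_ hF).
rewrite /F derivB !derivZ !deriv_exp /P /S !derivD !derivZ !derivC !derivXn.
rewrite !hornerE /= !hornerMn !hornerE /= -gE -tE.
clear F0 hF FE PE SE F P S.
clear hmax; rewrite !hornerMn !hornerXn.
case: d d0 gE tE => // d _ _ _.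
have -> : ((2 * d.+1).-1 = d + d.+1)%N by rewrite mul2n -addnn.
have -> : t ^+ (2 * d.+1) = t * t ^+ (d + d.+1).
  by rewrite -exprS mul2n -addnn.
rewrite (exprD x0) !(exprS x0 d) (exprS g d.+1).
set T := t ^+ _; set X := x0 ^+ d; set G := g ^+ d.+1; move=> h.
(* Here [d.+1] is the former [d]. The derivative is this factor, nonzero because [x0 > 0], times the
   stationarity equation cleared of its denominator. *)
have nz : 2 * d.+1%:R * d.+2%:R * T * G * X != 0.
  by rewrite !mulf_neq0 ?pnatr_eq0 ?expf_neq0 // gt_eqF.
have {}h : (2 * d.+1%:R * d.+2%:R * T * G * X) * (t * (b * (x0 * X) + a) - g * x0) = 0.
  by rewrite -[RHS]h; ring.
move/eqP: h; rewrite mulf_eq0 (negbTE nz) subr_eq0 /= => /eqP h.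
apply: (mulfI (lt0r_neq0 t0)); rewrite h; field; exact: lt0r_neq0.
Qed.

End StationaryPoint.

Section PositiveFixedPoint.
Context {R : realType} {n : nat}.
Variables (d : nat) (A : 'I_n.+1 -> 'I_n.+1 -> R).
Hypothesis d_gt0 : (0 < d)%N.
Hypothesis A_gt0 : forall i j, 0 < A i j.
Hypothesis A_sym : forall i j, A i j = A j i.

Implicit Types u v : 'I_n.+1 -> R.

Definition energy u := \sum_i \sum_j A i j * (u i ^+ d * u j ^+ d).
Definition mass u := \sum_i u i ^+ d.+1.

Lemma energyZ k u : energy (fun i => k * u i) = k ^+ (2 * d) * energy u.
Proof.
rewrite /energy mulr_sumr; apply: eq_bigr => i _; rewrite mulr_sumr.
by apply: eq_bigr => j _; rewrite !exprMn mul2n -addnn exprD; ring.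
Qed.

Lemma massZ k u : mass (fun i => k * u i) = k ^+ d.+1 * mass u.
Proof. by rewrite /mass mulr_sumr; apply: eq_bigr => i _; rewrite exprMn. Qed.

Lemma mass_gt0 u : (forall i, 0 <= u i) -> (exists i, 0 < u i) -> 0 < mass u.
Proof.
move=> u0 [i ui]; rewrite /mass (bigD1 i) //=.
by rewrite ltr_pwDl ?exprn_gt0 // sumr_ge0 // => j _; rewrite exprn_ge0.
Qed.

Lemma energy_ge0 u : (forall i, 0 <= u i) -> 0 <= energy u.
Proof.
move=> u0; rewrite !sumr_ge0 // => i _; rewrite sumr_ge0 // => j _.
by rewrite !mulr_ge0 ?exprn_ge0 // ltW.
Qed.

Lemma energy_gt0 u : (forall i, 0 <= u i) -> (exists i, 0 < u i) -> 0 < energy u.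
Proof.
move=> u0 [i ui]; rewrite /energy (bigD1 i) //= (bigD1 i) //=.
rewrite -addrA ltr_pwDl ?mulr_gt0 ?exprn_gt0 // addr_ge0 // sumr_ge0 // => j _.
  by rewrite !mulr_ge0 ?exprn_ge0 // ltW.
by rewrite sumr_ge0 // => k _; rewrite !mulr_ge0 ?exprn_ge0 // ltW.
Qed.

Lemma sum_gt0_ex u : (forall i, 0 <= u i) -> \sum_i u i != 0 -> exists i, 0 < u i.
Proof.
move=> u0 su; apply: contrapT => h; move/eqP: su; apply.
rewrite big1 // => i _; apply/eqP; rewrite eq_le u0 andbT leNgt.
by apply/negP => ui; apply: h; exists i.
Qed.

(** A continuous quotient attains its maximum on the simplex, and scale invariance makes that
    maximum global. In cross-multiplied form the inequality also covers [v = 0]. *)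
Lemma ex_maximizer : exists u, [/\ forall i, 0 <= u i, exists i, 0 < u i &
  forall v, (forall i, 0 <= v i) ->
    energy v ^+ d.+1 * mass u ^+ (2 * d) <= energy u ^+ d.+1 * mass v ^+ (2 * d)].
Proof.
pose f (w : 'rV[R]_n.+1) :=
  energy (w ord0) ^+ d.+1 / mass (w ord0) ^+ (2 * d).
pose box := [set w : 'rV[R]_n.+1 | forall i, `[0, 1]%classic (w ord0 i)].
pose simplex := box `&` [set w | \sum_i w ord0 i = 1].
have boxP w : simplex w -> (forall i, 0 <= w ord0 i) /\ exists i, 0 < w ord0 i.
  move=> [wb w1]; have w0 i : 0 <= w ord0 i by have := wb i; rewrite /= in_itv /= => /andP[].
  by split=> //; apply: sum_gt0_ex => //; rewrite w1 oner_neq0.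
have contc i : continuous (fun w : 'rV[R]_n.+1 => w ord0 i) by exact: coord_continuous.
have contX i k : continuous (fun w : 'rV[R]_n.+1 => w ord0 i ^+ k).
  move=> w; apply: (@continuous_comp _ _ _ (fun w : 'rV[R]_n.+1 => w ord0 i)
    (fun x => x ^+ k)); [exact: contc|exact: exprn_continuous].
have contsum (F : 'I_n.+1 -> 'rV[R]_n.+1 -> R) :
    (forall i, continuous (F i)) -> continuous (fun w => \sum_i F i w).
  by move=> cF; apply: continuous_big => //; exact: add_continuous.
have contS := contsum (fun i w => w ord0 i) contc.
have csimplex : compact simplex.
  apply: compact_closedI.
    by apply: (@rV_compact R n.+1 (fun=> `[0, 1]%classic)) => i; exact: segment_compact.
  apply: (@preimage_closed _ _ (fun w : 'rV[R]_n.+1 => \sum_i w ord0 i) [set 1]).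
    by move=> w _; exact: contS.
  exact: closed_eq.
have contE : continuous (fun w : 'rV[R]_n.+1 => energy (w ord0)).
  apply: (contsum _) => i; apply: (contsum _) => j w.
  have cij := @continuousM R _ _ _ w (contX i d w) (contX j d w).
  exact: (@continuousM R _ (fun=> A i j) _ w (@cst_continuous _ _ _ w) cij).
have contM : continuous (fun w : 'rV[R]_n.+1 => mass (w ord0)).
  by apply: (contsum _) => i; exact: contX.
have [||w /set_mem ws wmax] := @EVT_max_rV R _ f simplex _ csimplex.
- exists (delta_mx ord0 ord0); split => [i|] /=.
    rewrite mxE eqxx /= in_itv /=; by case: eqP; rewrite ?ler01 ?lexx.
  rewrite (bigD1 ord0) //= mxE !eqxx big1 ?addr0 // => i.
  by rewrite mxE eqxx /= => /negbTE ->.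
- apply: continuous_in_subspaceT => w /set_mem /boxP[w0 wp].
  have cE := @continuous_comp _ _ _ _ (fun x : R => x ^+ d.+1) w (contE w)
    (@exprn_continuous R _ _).
  have cM := @continuous_comp _ _ _ _ (fun x : R => x ^+ (2 * d)) w (contM w)
    (@exprn_continuous R _ _).
  apply: (@continuousM R _ _ _ w cE); apply: (continuousV _ cM).
  by rewrite /= expf_neq0 // gt_eqF // mass_gt0.
have [w0 wp] := boxP _ ws; exists (w ord0); split => // v v0.
have [v1|v1] := eqVneq (\sum_i v i) 0.
  have vz i : v i = 0.
    have /eqP := v1; rewrite psumr_eq0 // => /allP/(_ i).
    by rewrite mem_index_enum => /(_ isT)/eqP.
  have -> : energy v = 0.
    rewrite /energy big1 // => i _; rewrite big1 // => j _.
    by rewrite vz expr0n gtn_eqF // mul0r mulr0.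
  rewrite expr0n mul0r mulr_ge0 ?exprn_ge0 ?energy_ge0 // sumr_ge0 // => i _.
  by rewrite exprn_ge0.
pose k := (\sum_i v i)^-1.
have sv : 0 < \sum_i v i by rewrite lt_neqAle eq_sym v1 sumr_ge0.
have k0 : 0 < k by rewrite invr_gt0.
have kv1 : \sum_i k * v i = 1 by rewrite -mulr_sumr mulVf.
have ksimplex : (\row_i (k * v i)) \in simplex.
  apply/mem_set; split => [i|] /=; last by rewrite -kv1; apply: eq_bigr => i _; rewrite mxE.
  rewrite mxE in_itv /= mulr_ge0 ?(ltW k0) //= -kv1 (bigD1 i) //= lerDl sumr_ge0 // => j _.
  by rewrite mulr_ge0 // ltW.
have := wmax _ ksimplex; rewrite /f.
have -> : (\row_i (k * v i)) ord0 = fun i => k * v i.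
  by apply/funext => i; rewrite mxE.
rewrite energyZ massZ !exprMn -!exprM [(2 * d * _)%N]mulnC.
have Mw : 0 < mass (w ord0) by exact: mass_gt0.
have Mv : 0 < mass v by apply: mass_gt0 => //; exact: sum_gt0_ex.
rewrite -mulf_div divff ?expf_neq0 ?gt_eqF // mul1r.
by rewrite ler_pdivlMr ?exprn_gt0 // mulrAC ler_pdivrMr ?exprn_gt0.
Qed.

Definition set_coord u (i : 'I_n.+1) (x : R) : 'I_n.+1 -> R :=
  fun j => if j == i then x else u j.

Lemma mass_set_coord u i x :
  mass (set_coord u i x) = x ^+ d.+1 + \sum_(j | j != i) u j ^+ d.+1.
Proof.
rewrite /mass (bigD1 i) //= /set_coord eqxx; congr (_ + _).
by apply: eq_bigr => j /negbTE ->.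
Qed.

(** In one coordinate [x] the energy is a quadratic polynomial in [x ^ d], which is the shape
    treated by [quotient_maximizer]. *)
Lemma energy_set_coord u i x : energy (set_coord u i x) =
  A i i * x ^+ (2 * d) + 2 * (\sum_(j | j != i) A i j * u j ^+ d) * x ^+ d +
  \sum_(k | k != i) \sum_(j | j != i) A k j * (u k ^+ d * u j ^+ d).
Proof.
rewrite /energy (bigD1 i) //= (bigD1 i) //= {1 2 3}/set_coord eqxx.
rewrite -exprD addnn -mul2n.
under eq_bigr => j /negbTE ji do rewrite /set_coord ji [x ^+ d * _]mulrC mulrA.
rewrite -mulr_suml -addrA -addrA; congr (_ + _).
under [X in _ + X = _]eq_bigr => k ki.
  rewrite (bigD1 i) //= {1 2}/set_coord (negbTE ki) eqxx mulrA (A_sym k i).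
  under eq_bigr => j /negbTE ji do rewrite /set_coord ji (negbTE ki).
over.
rewrite big_split /= -mulr_suml. ring.
Qed.

(** Stationarity in each coordinate gives the equation with the common constant
    [K = energy u / mass u]. The maximality is kept, to be compared with explicit competitors. *)
Lemma ex_positive_fixed_point : (0 < n)%N ->
  exists u K, [/\ forall i, 0 < u i, 0 < K,
    forall i, \sum_j A i j * u j ^+ d = K * u i &
    forall v, (forall i, 0 <= v i) ->
      energy v ^+ d.+1 * mass u ^+ (2 * d) <= energy u ^+ d.+1 * mass v ^+ (2 * d)].
Proof.
move=> n0; have [u [u0 up umax]] := ex_maximizer.
have Eu := energy_gt0 u0 up; have Mu := mass_gt0 u0 up.
have upd i : set_coord u i (u i) = u.
  by apply/funext => j; rewrite /set_coord; case: eqP => // ->.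
suff h i : 0 < u i /\ \sum_j A i j * u j ^+ d = energy u / mass u * u i.
  exists u, (energy u / mass u); split => // [i||i].
  - by case: (h i).
  - by rewrite divr_gt0.
  - by case: (h i).
have key k : 0 < \sum_(j | j != k) A k j * u j ^+ d ->
    0 < u k /\ \sum_j A k j * u j ^+ d = energy u / mass u * u k.
  clear i; move: k => i a0.
  have [] := @quotient_maximizer R d _ (A i i)
    (\sum_(k | k != i) \sum_(j | j != i) A k j * (u k ^+ d * u j ^+ d))
    (\sum_(j | j != i) u j ^+ d.+1) (energy u) (mass u) (u i) d_gt0 a0.
  - exact: ltW.
  - rewrite sumr_ge0 // => k _; rewrite sumr_ge0 // => j _.
    by rewrite !mulr_ge0 ?exprn_ge0 // ltW.
  - by rewrite sumr_ge0 // => j _; rewrite exprn_ge0.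
  - exact: u0.
  - by rewrite -{1}(upd i) energy_set_coord.
  - exact: Eu.
  - by rewrite -{1}(upd i) mass_set_coord.
  - exact: Mu.
  - move=> x x0; rewrite -energy_set_coord -mass_set_coord; apply: umax => j.
    by rewrite /set_coord; case: eqP.
  by move=> ui <-; split => //; rewrite (bigD1 i).
have t0 k j : 0 <= A k j * u j ^+ d by rewrite mulr_ge0 ?exprn_ge0 // ltW.
(* Coordinate [i] must interact with a positive coordinate other than itself. Otherwise all of [u]
   sits at [i]; then any other [j] interacts with [i], and [key] makes [u j] positive, a
   contradiction. *)
apply: (key _); rewrite lt_neqAle sumr_ge0 // andbT eq_sym; apply/negP.
rewrite psumr_eq0 // => /allP az.
have uz j : j != i -> u j = 0.
  move=> ji; have := az j; rewrite mem_index_enum ji => /(_ isT) /=.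
  by rewrite mulf_eq0 gt_eqF //= expf_eq0 => /andP[_ /eqP].
have ui : 0 < u i.
  by have [j uj] := up; have [<-//|/uz uj0] := eqVneq j i; rewrite uj0 ltxx in uj.
have [j ji] : exists j : 'I_n.+1, j != i.
  exists (lift i (Ordinal n0)); by rewrite eq_sym neq_lift.
have [|uj _] := key j.
  rewrite (bigD1 i) 1?eq_sym //= ltr_pwDl ?mulr_gt0 ?exprn_gt0 //.
  by rewrite sumr_ge0.
by rewrite uz // ltxx in uj.
Qed.
End PositiveFixedPoint.

(** * Sums of nonnegative families and countable additivity *)

Section EsumComplements.
Context {R : realType}.
Local Open Scope ereal_scope.

Lemma esumZl (T : choiceType) (D : set T) (a : T -> \bar R) (k : R) :
  (0 <= k)%R -> (forall i, 0 <= a i) ->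
  \esum_(i in D) (k%:E * a i) = k%:E * \esum_(i in D) a i.
Proof.
move=> k0 a0; have [->|kn0] := eqVneq k 0%R.
  by rewrite mul0e esum1 // => i _; rewrite mul0e.
(* One inequality for every positive constant is enough: the reverse one is the same inequality for
   [k^-1]. *)
have half (c : R) (b : T -> \bar R) : (0 < c)%R -> (forall i, 0 <= b i) ->
    \esum_(i in D) (c%:E * b i) <= c%:E * \esum_(i in D) b i.
  move=> c0 b0; apply: ge_ereal_sup => /= _ [X [finX XD] <-].
  rewrite -ge0_mule_fsumr // lee_pmul2l // esum_ge //.
  by exists X.
have kp : (0 < k)%R by rewrite lt_neqAle eq_sym kn0.
apply/eqP; rewrite eq_le half //=.
rewrite -(@lee_pmul2l _ k^-1%:E) ?lte_fin ?invr_gt0 //.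
rewrite muleA -EFinM mulVf // mul1e.
apply: le_trans (half k^-1%R (fun i => k%:E * a i) _ _); rewrite ?invr_gt0 //.
  by apply: le_esum => i _; rewrite muleA -EFinM mulVf // mul1e.
by move=> i; rewrite mule_ge0 // lee_fin ltW.
Qed.

Lemma esum_fibers (T T' : choiceType) (f : T -> T') (D : set T)
    (a : T -> \bar R) : (forall i, 0 <= a i) ->
  \esum_(i in D) a i =
  \esum_(t in [set: T']) \esum_(i in D `&` [set i | f i = t]) a i.
Proof.
move=> a0; rewrite esum_esum //.
rewrite (reindex_esum D _ (fun i => (f i, i))) //; split => //=.
- by move=> i j _ _ [].
- by move=> [t i] /= [_ [Di <-]]; exists i.
Qed.

Lemma esum_finType (T : finType) (a : T -> \bar R) : (forall i, 0 <= a i) ->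
  \esum_(i in [set: T]) a i = \sum_i a i.
Proof.
move=> a0; rewrite esum_fset //; last exact: finite_finset.
rewrite [RHS]bigfs ?index_enum_uniq //; first by rewrite set_true.
by move=> i _; rewrite mem_index_enum.
Qed.

Lemma esum_le_subset (T : choiceType) (D E : set T) (a : T -> \bar R) :
  (forall i, 0 <= a i) -> D `<=` E -> \esum_(i in D) a i <= \esum_(i in E) a i.
Proof.
move=> a0 DE; rewrite [leLHS]esum_mkcond [leRHS]esum_mkcond.
apply: le_esum => i _; case: ifPn => [/set_mem/DE/mem_set -> //|_].
by case: ifPn.
Qed.

(** Numbers that code nothing contribute 0. This links sums over a countable type with the series
    along its codes, which countable additivity and the construction of nested intervals require. *)
Lemma nneseries_pickle (T : countType) (a : T -> \bar R) : (forall k, 0 <= a k) ->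
  \sum_(0 <= n <oo) (if choice.pickle_inv n is Some k then a k else 0) =
  \esum_(k in [set: T]) a k.
Proof.
move=> a0; pose w n := if choice.pickle_inv n is Some k then a k else 0; rewrite -/w.
have w0 n : 0 <= w n by rewrite /w; case: choice.pickle_inv => [k|]; rewrite ?a0.
rewrite nneseries_esumT; last exact: w0.
rewrite (esumID [set n | (choice.pickle_inv n : option T)]); last by move=> n _; exact: w0.
rewrite setTI [X in _ + X]esum1 ?adde0.
  rewrite (reindex_esum [set: T] _ choice.pickle).
    by apply: eq_esum => k _; rewrite /w choice.pickleK_inv.
  split=> /=.
  - by move=> k _ /=; rewrite choice.pickleK_inv.
  - by move=> k k' _ _; exact: (pcan_inj choice.pickleK_inv).
  - move=> n /=; case E : choice.pickle_inv => [k|//] _; exists k => //.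
    by have := @choice.pickle_invK T n; rewrite E.
by move=> n [_ /=]; rewrite /w; case: choice.pickle_inv => [k []|].
Qed.

Lemma measure_countable_bigcup (disp : measure_display) (T : measurableType disp)
    (mu : {measure set T -> \bar R}) (I : countType) (F : I -> set T) :
  (forall i, measurable (F i)) -> (forall i j x, F i x -> F j x -> i = j) ->
  mu (\bigcup_i F i) = \esum_(i in [set: I]) mu (F i).
Proof.
move=> mF tF; rewrite -nneseries_pickle; last by move=> k; exact: measure_ge0.
pose G n := if choice.pickle_inv n is Some i then F i else set0.
have -> : \bigcup_i F i = \bigcup_n G n.
  apply/seteqP; split => [x [i _ Fx]|x [n _]].
    by exists (choice.pickle i) => //; rewrite /G choice.pickleK_inv.
  by rewrite /G; case: choice.pickle_inv => // i Fx; exists i.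
have mG n : measurable (G n) by rewrite /G; case: choice.pickle_inv.
rewrite measure_semi_bigcup //; last exact: bigcupT_measurable.
  by apply: eq_eseriesr => n _; rewrite /G; case: choice.pickle_inv.
move=> n m _ _ [x []]; rewrite /G.
have := @choice.pickle_invK I n; have := @choice.pickle_invK I m.
case: (choice.pickle_inv n) => // i; case: (choice.pickle_inv m) => // j /= <- <-.
by move=> Fi Fj; rewrite (tF _ _ _ Fi Fj).
Qed.

End EsumComplements.

(** * Reduction of sums over the integers to sums over classes modulo q *)

Section Periodisation.
Context {R : realType}.
Variables (Q : int -> R) (q : nat).
Hypothesis Q_l1 : summable [set: int] (fun i => (Q i)%:E).
Hypothesis Q_gt0 : forall i, 0 < Q i.
Hypothesis Q_even : forall i, Q (- i) = Q i.

Let Q_ge0 i : (0 <= (Q i)%:E)%E. Proof. by rewrite lee_fin ltW. Qed.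

Lemma esumQ_fin (D : set int) : (\esum_(l in D) (Q l)%:E)%E \is a fin_num.
Proof.
have := Q_l1; rewrite /summable; under eq_esum do rewrite gee0_abs //.
move=> h; rewrite ge0_fin_numE; last exact: esum_ge0.
by apply: le_lt_trans h; exact: esum_le_subset.
Qed.

Lemma rsumQE (D : set int) : ((rsum D Q)%:E = \esum_(l in D) (Q l)%:E)%E.
Proof. by rewrite /rsum fineK ?esumQ_fin. Qed.

Lemma rsumQ_ge (D : set int) l : D l -> Q l <= rsum D Q.
Proof.
move=> Dl; rewrite -lee_fin rsumQE -(@esum_set1 _ _ l (fun l => (Q l)%:E)) //.
by apply: esum_le_subset => // i ->.
Qed.

Lemma rsumQ_setD1 : rsum [set: int] Q = Q 0 + rsum (~` [set 0]) Q.
Proof.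
apply: EFin_inj; rewrite EFinD !rsumQE (esumID [set 0]) //.
by rewrite !setTI esum_set1.
Qed.

Lemma Zq_surj (s : 'Z_q) : ((Posz (val s))%:~R = s :> 'Z_q).
Proof. by rewrite -[RHS]natr_Zp. Qed.

Lemma QqE (s : 'Z_q) :
  ((Qq Q s)%:E = \esum_(l in [set l | l%:~R = s]) (Q l)%:E)%E.
Proof. exact: rsumQE. Qed.

Lemma Qq_gt0 (s : 'Z_q) : 0 < Qq Q s.
Proof.
apply: lt_le_trans (Q_gt0 (Posz (val s))) _; apply: rsumQ_ge.
exact: Zq_surj.
Qed.

Lemma Qq_even (s : 'Z_q) : Qq Q (- s) = Qq Q s.
Proof.
apply: EFin_inj; rewrite !QqE (reindex_esum [set l : int | l%:~R = s] _ -%R) /=.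
  by apply: eq_esum => l _; rewrite Q_even.
split=> //=.
- by move=> l /= <-; rewrite mulrNz.
- by move=> l l' _ _ /oppr_inj.
- by move=> l /= ls; exists (- l); rewrite /= ?opprK // mulrNz ls opprK.
Qed.

Lemma Qq0_ge : Q 0 <= Qq Q (0 : 'Z_q).
Proof. by apply: rsumQ_ge. Qed.

Lemma sum_Qq : \sum_(s : 'Z_q) Qq Q s = rsum [set: int] Q.
Proof.
apply: EFin_inj; rewrite rsumQE (@esum_fibers _ _ _ (fun l => l%:~R : 'Z_q)) //.
rewrite esum_finType; last by move=> i; exact: esum_ge0.
rewrite -sumEFin; apply: eq_bigr => s _; rewrite QqE.
by congr esum; rewrite setTI.
Qed.

(** Grouping [j] by its class [t], the map [j |-> i - j] carries that class onto the class of
    [i - t], over which [Q] sums to [Qq]. The boundary law equation thereby becomes finite. *)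
Lemma esum_periodise (f : 'Z_q -> R) (i : int) : (forall t, 0 <= f t) ->
  (\esum_(j in [set: int]) (Q (i - j) * f j%:~R)%:E =
   (\sum_t Qq Q (i%:~R - t) * f t)%:E)%E.
Proof.
move=> f0; rewrite (@esum_fibers _ _ _ (fun l => l%:~R : 'Z_q)) //; last first.
  by move=> j; rewrite lee_fin mulr_ge0 // ltW.
rewrite esum_finType; last first.
  by move=> j; apply: esum_ge0 => ? _; rewrite lee_fin mulr_ge0 // ltW.
rewrite -sumEFin; apply: eq_bigr => t _; rewrite setTI mulrC EFinM QqE -esumZl //.
rewrite (reindex_esum [set j : int | j%:~R = t] [set l : int | l%:~R = i%:~R - t]
  (fun j => i - j)) /=.
  by apply: eq_esum => j /= <-; rewrite -EFinM mulrC.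
split => /=.
- by move=> j /= <-; rewrite rmorphB.
- by move=> j j' _ _ /addrI/oppr_inj.
- move=> l /= ls; exists (i - l); rewrite /= ?subKr //.
  by rewrite rmorphB /= ls subKr.
Qed.

Lemma rsum_periodise (f : 'Z_q -> R) (i : int) : (forall t, 0 <= f t) ->
  rsum [set: int] (fun j => Q (i - j) * f j%:~R) =
  \sum_t Qq Q (i%:~R - t) * f t.
Proof. by move=> f0; rewrite /rsum esum_periodise. Qed.

End Periodisation.

(** * A non-constant solution on Z/qZ *)

Section BoundaryLawExistence.
Context {R : realType}.
Variables (Q : int -> R) (q d : nat).
Hypothesis q_ge2 : (2 <= q)%N.
Hypothesis d_gt0 : (0 < d)%N.
Hypothesis Q_l1 : summable [set: int] (fun i => (Q i)%:E).
Hypothesis Q_gt0 : forall i, 0 < Q i.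
Hypothesis Q_even : forall i, Q (- i) = Q i.
Hypothesis Q_0 : Q 0 = 1.

(** For [q < 2] the type ['Z_q] still has two elements, hence the hypothesis on [q]. *)
Lemma card_Zq : #|'Z_q| = q.
Proof. by rewrite card_ord Zp_cast. Qed.

Lemma Zq_shift_invariant (U : 'Z_q -> R) :
  (forall s, U (s + 1) = U s) -> forall s, U s = U 0.
Proof.
move=> h s; rewrite -[s]natr_Zp; elim: (val s) => // m IH.
by rewrite -natr1 h.
Qed.

(** A constant maximizer would lose against the indicator of 0. Non-constancy is stated for
    consecutive classes because the increment 1 on an edge compares [U s] with [U (s + 1)]. *)
Lemma nonconstant_fixed_point :
  rsum [set: int] Q ^+ d.+1 < q%:R ^+ d.-1 ->
  exists (U : 'Z_q -> R) (K : R), [/\ forall s, 0 < U s, 0 < K,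
    forall s, \sum_t Qq Q (s - t) * U t ^+ d = K * U s &
    exists s, U (s + 1) != U s].
Proof.
set S := rsum _ _ => hS.
have Agt0 (i j : 'Z_q) : 0 < Qq Q (i - j) by exact: Qq_gt0.
have Asym (i j : 'Z_q) : Qq Q (i - j) = Qq Q (j - i) by rewrite -opprB Qq_even.
have [//|U [K [U0 K0 UK Umax]]] :=
  @ex_positive_fixed_point R (Zp_trunc q).+1 d _ d_gt0 Agt0 Asym.
exists U, K; split => //; apply: contrapT => hconst.
have {hconst} Uc s : U s = U 0.
  by apply: Zq_shift_invariant => t; apply/eqP/negPn/negP => h; apply: hconst; exists t.
set c := U 0 in Uc; have c0 : 0 < c by exact: U0.
have rowsum (i : 'Z_q) : \sum_j Qq Q (i - j) = S.
  rewrite /S -(@sum_Qq R Q q) // [RHS](reindex_inj (inv_inj (subKr i))) /=.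
  by apply: eq_bigr.
have EU : energy d (fun i j : 'Z_q => Qq Q (i - j)) U = q%:R * S * c ^+ (2 * d).
  rewrite /energy; under eq_bigr do under eq_bigr do rewrite !Uc -exprD addnn -mul2n.
  under eq_bigr do rewrite -mulr_suml rowsum.
  rewrite sumr_const card_Zq. by rewrite -[_ *+ q]mulr_natl mulrA.
have MU : mass d U = q%:R * c ^+ d.+1.
  by rewrite /mass; under eq_bigr do rewrite Uc; rewrite sumr_const card_Zq mulr_natl.
pose v (i : 'Z_q) : R := (i == 0)%:R.
have vz i : i != 0 -> v i = 0 by rewrite /v => /negbTE ->.
have Ev : 1 <= energy d (fun i j : 'Z_q => Qq Q (i - j)) v.
  rewrite /energy (bigD1 0) //= (bigD1 0) //= {1 2}/v eqxx !expr1n subr0 !mulr1.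
  rewrite -addrA; apply: le_trans (_ : Qq Q (0 : 'Z_q) <= _).
    by rewrite -Q_0; exact: Qq0_ge.
  rewrite lerDl addr_ge0 // sumr_ge0 // => i _; rewrite ?sumr_ge0 // => *;
    by rewrite !mulr_ge0 ?exprn_ge0 /v ?ler0n // ltW.
have Mv : mass d v = 1.
  rewrite /mass (bigD1 0) //= {1}/v eqxx expr1n big1 ?addr0 // => i /vz ->.
  by rewrite expr0n.
have := Umax v (fun i => ler0n _ _); rewrite EU MU Mv expr1n mulr1 => h.
have q0 : 0 < q%:R :> R by rewrite ltr0n ltnW.
have {h} : (q%:R * c ^+ d.+1) ^+ (2 * d) <= (q%:R * S * c ^+ (2 * d)) ^+ d.+1.
  apply: le_trans h; rewrite ler_peMl ?exprn_ge0 ?mulr_ge0 ?exprn_ge0 ?(ltW c0) //.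
  exact: exprn_ege1.
rewrite !exprMn -!exprM [(d.+1 * _)%N]mulnC ler_pM2r ?exprn_gt0 //.
(* What remains is [q ^ (2 d) <= (q S) ^ (d + 1)]; splitting the exponent leaves
   [q ^ (d - 1) <= S ^ (d + 1)], against the hypothesis. *)
have -> : (2 * d = d.+1 + d.-1)%N by rewrite mul2n -addnn addSn -addnS prednK.
by rewrite exprD ler_pM2l ?exprn_gt0 // leNgt hS.
Qed.

End BoundaryLawExistence.

(** * Processes with prescribed marginals on the unit interval *)

Section NestedIntervals.
Context {R : realType} {T : countType}.
Variables (t0 : T) (p : seq T -> R).
Hypothesis p_ge0 : forall s, 0 <= p s.
Hypothesis p_nil : p [::] = 1.
Hypothesis p_cons :
  forall s, (\esum_(k in [set: T]) (p (k :: s))%:E = (p s)%:E)%E.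

(** Weights of the children of the history [s], in the order of their codes; numbers that code
    nothing get weight 0. *)
Let w (s : seq T) (n : nat) : R :=
  if choice.pickle_inv n is Some k then p (k :: s) else 0.

Let cum (s : seq T) (n : nat) : R := \sum_(0 <= j < n) w s j.

Let w_ge0 s n : 0 <= w s n.
Proof. by rewrite /w; case: choice.pickle_inv. Qed.

Let w_pickle s k : w s (choice.pickle k) = p (k :: s).
Proof. by rewrite /w choice.pickleK_inv. Qed.

Let sum_w s : (\sum_(0 <= n <oo) (w s n)%:E = (p s)%:E)%E.
Proof.
rewrite -p_cons -nneseries_pickle; last by move=> k; rewrite lee_fin.
by apply: eq_eseriesr => n _; rewrite /w; case: choice.pickle_inv.
Qed.

Let cum_le s m n : (m <= n)%N -> cum s m <= cum s n.
Proof.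
move=> mn; rewrite /cum (big_cat_nat (leq0n m) mn) //= lerDl sumr_ge0 // => i _.
Qed.

Let cum_lt s x : x < p s -> exists n, x < cum s n.
Proof.
move=> xp; apply: contrapT => h.
have : ((p s)%:E <= x%:E)%E.
  rewrite -sum_w; apply: lime_le; first by apply: is_cvg_nneseries => n _ _; rewrite lee_fin.
  apply: nearW => n; rewrite sumEFin lee_fin leNgt; apply/negP => hn.
  by apply: h; exists n.
by rewrite lee_fin leNgt xp.
Qed.

Let cum_le_p s n : cum s n <= p s.
Proof.
rewrite -lee_fin -sum_w /cum -sumEFin.
by apply: nneseries_lim_ge => m _ _; rewrite lee_fin.
Qed.

(** Histories list the latest value first. The intervals of the children of [s] are laid side by
    side from the left end of the interval of [s]. *)
Fixpoint left_end (s : seq T) : R :=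
  if s is k :: s' then left_end s' + cum s' (choice.pickle k) else 0.

Definition history_interval (s : seq T) : set R :=
  `[left_end s, left_end s + p s[%classic.

Let HI := history_interval.

Let HI_cons k s x : HI (k :: s) x -> HI s x.
Proof.
rewrite /HI /history_interval /= !in_itv /= => /andP[h1 h2]; apply/andP; split.
  apply: le_trans h1; rewrite lerDl /cum sumr_ge0 // => i _.
apply: (lt_le_trans h2); rewrite -addrA lerD2l -w_pickle.
by apply: le_trans (cum_le_p s (choice.pickle k).+1); rewrite /cum big_nat_recr.
Qed.

Let HI_inj k k' s x : HI (k :: s) x -> HI (k' :: s) x -> k = k'.
Proof.
move=> h h'; apply: (pcan_inj choice.pickleK_inv).
have half j j' : HI (j :: s) x -> HI (j' :: s) x ->
    ~~ (choice.pickle j < choice.pickle j')%N.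
  rewrite /HI /history_interval /= !in_itv /= => /andP[_ h2] /andP[h3 _].
  apply/negP => /(cum_le s); rewrite {1}/cum big_nat_recr //= w_pickle => h4.
  have : left_end s + cum s (choice.pickle j) + p (j :: s) <= x.
    by apply: le_trans h3; rewrite -addrA lerD2l.
  by rewrite leNgt h2.
by apply/eqP; rewrite eqn_leq leqNgt (half k' k) //= leqNgt (half k k').
Qed.

Let HI_ex s x : HI s x -> exists k, HI (k :: s) x.
Proof.
rewrite {1}/HI /history_interval /= !in_itv /= => /andP[h1 h2].
have /cum_lt ex : x - left_end s < p s by rewrite ltrBlDl.
(* The least partial sum exceeding the offset of [x]. The child containing [x] is the one just
   before it, whence the shift by one; its weight is nonzero, so its number is a code. *)
case: (ex_minnP ex) => -[|n] hn hmin.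
  by move: hn; rewrite /cum big_geq // subr_lt0 ltNge h1.
have hn' : cum s n <= x - left_end s.
  by rewrite leNgt; apply/negP => /hmin; rewrite ltnn.
have : 0 < w s n.
  rewrite lt_neqAle w_ge0 andbT; apply/eqP => wn; move: hn.
  by rewrite /cum big_nat_recr //= -wn addr0 ltNge -/(cum s n) hn'.
rewrite /w; case E : choice.pickle_inv => [k|]; last by rewrite ltxx.
have nk : choice.pickle k = n by have := @choice.pickle_invK T n; rewrite E.
move=> _; exists k; rewrite /HI /history_interval /= in_itv /= nk.
rewrite -lerBrDl hn' /= -addrA -ltrBlDl.
by move: hn; rewrite /cum big_nat_recr //= -nk w_pickle.
Qed.

(** The default [t0] occurs only for [x] outside [[0, 1[]: inside, exactly one child interval
    contains [x] at each stage. *)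
Fixpoint history (x : R) (n : nat) : seq T :=
  if n is m.+1 then
    xget t0 [set k | HI (k :: history x m) x] :: history x m
  else [::].

Lemma history_event s :
  `[0, 1[%classic `&` [set x | history x (size s) = s] = history_interval s.
Proof.
apply/seteqP; split => [x [x01 /= hx]|x].
  rewrite -hx; elim: (size s) => [|n IH] /=.
    by rewrite /history_interval /= p_nil add0r.
  case: xgetP => [k -> //|/= h].
  by have [k hk] := HI_ex IH; case: (h k).
elim: s x => [|k s IH] x hx /=.
  by split => //; move: hx; rewrite /history_interval /= p_nil add0r.
have [x01 /= sx] := IH _ (HI_cons hx); split => //=; rewrite sx; congr (_ :: _).
case: xgetP => [k' _ hk'|/(_ k)[]//]; exact: HI_inj hk' hx.
Qed.

Lemma lebesgue_history s :
  lebesgue_measure (history_interval s) = (p s)%:E.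
Proof.
rewrite /history_interval lebesgue_measure_itv /= lte_fin ltrDl.
have [ps|ps] := ltP 0 (p s); first by rewrite EFinD addeAC -EFinB subrr add0e.
by congr _%:E; apply/eqP; rewrite eq_le p_ge0 ps.
Qed.

End NestedIntervals.

(** * Trees, heights and gradients *)

Section Tree.
Context {V : countType} {e : rel V} {d : nat}.
Hypothesis tree : cayley_tree e d.
Local Open Scope fset_scope.

Implicit Types (L M : {fset V}) (x y z w : V).

Lemma edge_sym : symmetric e. Proof. by case: tree => -[]. Qed.
Lemma edge_irr : irreflexive e. Proof. by case: tree => -[]. Qed.

Lemma edge_neq x y : e x y -> x != y.
Proof. by move=> exy; apply: contraTneq exy => ->; rewrite edge_irr. Qed.

Lemma finite_neighbours x : finite_set [set y | e x y].
Proof. by case: tree => _ _ _ _ /(_ x) h; exists d.+1. Qed.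

Definition neighbours x : {fset V} := fset_set [set y | e x y].

Lemma in_neighbours x y : (y \in neighbours x) = e x y.
Proof.
rewrite in_fset_set; last exact: finite_neighbours.
by apply/idP/idP; rewrite inE.
Qed.

Lemma card_neighbours x : #|` neighbours x| = d.+1.
Proof. by apply: card_fset_set; case: tree => _ _ _ _ /(_ x). Qed.

(** Otherwise the path from [z] to [y], shortened to a simple one, would close up through [x] to a
    cycle of length at least 3. *)
Lemma no_detour x y z p : e x z -> e x y -> path.path e z p -> last z p = y ->
  x \notin z :: p -> z = y.
Proof.
move=> exz exy zp lzp; case/shortenP: zp lzp => p' zp' up' sp' lzp xzp.
have xzp' : x \notin z :: p'.
  apply: contra xzp; rewrite !inE => /orP[->//|/sp' ->]; by rewrite orbT.
case: tree => _ _ _ /(_ [:: x, z & p']) acyc _.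
have : (size [:: x, z & p'] <= 2)%N.
  apply: acyc; last by rewrite cons_uniq xzp'.
  by rewrite /= exz rcons_path zp' lzp edge_sym.
by case: p' zp' up' sp' lzp xzp' acyc.
Qed.

(** A path inside [L] between two neighbours of [y] would be a detour around [y]. Hence a vertex
    attached to a connected set is a leaf of the enlarged set. *)
Lemma unique_neighbour L x x' y : connected_fset e L -> x \in L -> x' \in L ->
  y \notin L -> e x y -> e x' y -> x = x'.
Proof.
move=> cL xL x'L yL exy ex'y; have [p [xp pL lp]] := cL _ _ xL x'L.
apply: (no_detour (x := y) _ _ xp lp); rewrite ?[e y _]edge_sym //.
rewrite inE negb_or; apply/andP; split; first by apply: contraNneq yL => ->.
exact: contra (pL y) yL.
Qed.

Lemma connected1 x : connected_fset e [fset x].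
Proof.
by move=> a b; rewrite !inE => /eqP -> /eqP ->; exists [::]; split.
Qed.

Lemma connected_add L x y : connected_fset e L -> x \in L -> e x y ->
  connected_fset e (y |` L).
Proof.
move=> cL xL exy.
have sub p : {subset p <= L} -> {subset p <= y |` L}.
  by move=> pL z /pL zL; rewrite !inE zL orbT.
have yL : y \in y |` L by rewrite !inE eqxx.
move=> a b; rewrite !inE => /orP[/eqP ->|aL] /orP[/eqP ->|bL].
- by exists [::]; split.
- have [p [xp pL lp]] := cL _ _ xL bL; exists (x :: p); split => //=.
    by rewrite edge_sym exy.
  by apply: sub => z; rewrite inE => /orP[/eqP ->|/pL].
- have [p [xp pL lp]] := cL _ _ aL xL; exists (rcons p y); split => //=.
  + by rewrite rcons_path xp lp.
  + move=> z; rewrite mem_rcons inE => /orP[/eqP ->//|zp].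
    by rewrite !inE pL ?orbT.
  + by rewrite last_rcons.
- by have [p [xp pL lp]] := cL _ _ aL bL; exists p; split => //; exact: sub.
Qed.

Lemma path_exit (S : pred V) a p : path.path e a p -> S a -> ~~ S (last a p) ->
  exists x y, [/\ S x, ~~ S y, e x y, x \in a :: p & y \in p].
Proof.
elim: p a => [|b p IH] a /=; first by move=> _ ->.
move=> /andP[eab bp] Sa Sl; have [Sb|Sb] := boolP (S b).
  have [x [y [Sx Sy exy xp yp]]] := IH b bp Sb Sl.
  by exists x, y; split => //; rewrite inE ?xp ?yp orbT.
by exists a, b; split => //; rewrite inE eqxx.
Qed.

(** Induction by adding leaves: a path inside [M] from [L] to a vertex still missing leaves the
    current set along an edge, and the far end of that edge is added. *)
Lemma growth_ind (P : {fset V} -> Prop) L M :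
  connected_fset e L -> L != fset0 -> connected_fset e M -> L `<=` M -> P L ->
  (forall N x y, L `<=` N -> connected_fset e N -> x \in N -> y \notin N ->
     e x y -> P N -> P (y |` N)) ->
  P M.
Proof.
move=> cL L0 cM LM PL step.
suff h n N : #|` M `\` N| = n -> L `<=` N -> N `<=` M -> connected_fset e N ->
    P N -> P M by exact: (h _ L erefl).
elim: n N => [|n IH] N cardN LN NM cN PN.
  suff -> : M = N by [].
  apply/eqP; rewrite eqEfsubset NM andbT -fsetD_eq0 -cardfs_eq0.
  by rewrite cardN.
have [a aL] := fset0Pn _ L0; have aN := fsubsetP LN _ aL.
have [b] : exists b, b \in M `\` N by apply/fset0Pn; rewrite -cardfs_eq0 cardN.
rewrite inE => /andP[bN bM].
have [p [ap pM lp]] := cM _ _ (fsubsetP NM _ aN) bM.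
have [|x [y [xN yN exy _ yp]]] := path_exit (S := mem N) ap aN; first by rewrite lp.
have yM := pM _ yp.
apply: (IH (y |` N)).
- have := cardN; rewrite (cardfsD1 y) inE yN yM /= add1n => -[<-].
  by congr #|` _|; apply/fsetP => z; rewrite !inE negb_or -andbA.
- by apply: fsubset_trans LN _; rewrite fsubsetUr.
- by rewrite fsubUset NM andbT fsub1set.
- exact: connected_add exy.
- exact: (step N x y).
Qed.

Lemma fset_exit L : L != fset0 -> exists x y, [/\ x \in L, y \notin L & e x y].
Proof.
move=> /fset0Pn[a aL].
have [b bL] : exists b, b \notin L.
  apply: contrapT => h; case: tree => _ + _ _ _; apply.
  apply: (sub_finite_set _ (finite_fset L)) => x _ /=.
  by apply: contrapT => /negP xL; apply: h; exists x.
case: tree => _ _ /(_ a b)[p ap lp] _ _.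
have [|x [y [xL yL exy _ _]]] := path_exit (S := mem L) ap aL; first by rewrite lp.
by exists x, y.
Qed.

(* The new vertex is the one with the least code among those adjacent to the
   current set; this makes the sequence exhaust the tree. *)
Lemma next_vertex L : L != fset0 -> exists x y,
  [/\ x \in L, y \notin L, e x y &
      forall x' y', x' \in L -> y' \notin L -> e x' y' ->
        (choice.pickle y <= choice.pickle y')%N].
Proof.
move=> /fset_exit ex.
pose f n := `[< exists x y, [/\ x \in L, y \notin L, e x y & choice.pickle y = n] >].
have [|n /asboolP[x [y [xL yL exy yn]]] hmin] := @ex_minnP f _.
  have [x [y [xL yL exy]]] := ex.
  by exists (choice.pickle y); apply/asboolP; exists x, y.
exists x, y; split => // x' y' x'L y'L ex'y'; rewrite yn; apply: hmin.
by apply/asboolP; exists x', y'.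
Qed.

(** An enumeration of the tree by successive leaves, with [vertex 0] as root. Note that [prefix n]
    has [n + 1] vertices and that [parent n] belongs to [vertex n.+1]. *)
Record exhaustion := Exhaustion {
  prefix : nat -> {fset V};
  vertex : nat -> V;
  parent : nat -> V;
  prefix0 : prefix 0 = [fset vertex 0];
  prefixS : forall n, prefix n.+1 = vertex n.+1 |` prefix n;
  vertex_new : forall n, vertex n.+1 \notin prefix n;
  parent_in : forall n, parent n \in prefix n;
  parent_edge : forall n, e (parent n) (vertex n.+1);
  prefix_exhaust : forall x, exists n, x \in prefix n }.

Lemma ex_exhaustion : inhabited exhaustion.
Proof.
have [r _] : exists r : V, True.
  apply: contrapT => h; case: tree => _ + _ _ _; apply.
  by apply: (@sub_finite_set _ _ set0) => // x _; case: h; exists x.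
pose good L (xy : V * V) := [/\ xy.1 \in L, xy.2 \notin L, e xy.1 xy.2 &
    forall x' y', x' \in L -> y' \notin L -> e x' y' ->
      (choice.pickle xy.2 <= choice.pickle y')%N].
have [|next nextP] := @boolp.choice _ _ (fun L xy => L != fset0 -> good L xy).
  move=> L; have [L0|/next_vertex[x [y ?]]] := eqVneq L fset0; first by exists (r, r).
  by exists (x, y).
pose M := fix M n := if n is m.+1 then (next (M m)).2 |` M m else [fset r].
pose v n := if n is m.+1 then (next (M m)).2 else r.
have M_neq0 n : M n != fset0.
  by apply/fset0Pn; exists (v n); case: n => [|n]; rewrite !inE eqxx.
have good_next n := nextP _ (M_neq0 n).
have M_mono m n : (m <= n)%N -> M m `<=` M n.
  move=> /subnKC <-; elim: (n - m)%N => [|k IH]; first by rewrite addn0.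
  by rewrite addnS; apply: fsubset_trans IH _; rewrite fsubsetUr.
have v_inj m n : (m < n)%N -> v m != v n.
  case: n => // n; rewrite ltnS => mn.
  have [_ + _ _] := good_next n; apply: contraNneq => vmn.
  rewrite -[X in X \in _]/(v n.+1) -vmn.
  by apply: (fsubsetP (M_mono m n mn)); case: (m) => [|k]; rewrite !inE eqxx.
apply: inhabits; apply: (@Exhaustion M v (fun n => (next (M n)).1)) => //.
- by move=> n; case: (good_next n).
- by move=> n; case: (good_next n).
- by move=> n; case: (good_next n).
move=> z; apply: contrapT => hz.
case: tree => _ _ /(_ r z)[p rp lp] _ _.
have [||x [y [/asboolP[n xn] /asboolPn yM exy _ _]]] :=
  path_exit (S := fun x => `[< exists n, x \in M n >]) rp.
- by apply/asboolP; exists 0%N; rewrite inE.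
- by rewrite lp; apply/asboolPn.
(* From stage [n] on, the never chosen [y] is a candidate, so every later vertex has a code at most
   that of [y]. The later vertices being distinct, this contradicts the pigeonhole principle. *)
have vy k : (choice.pickle (v (n + k).+1) <= choice.pickle y)%N.
  have [_ _ _ /(_ x y) hxy] := good_next (n + k)%N; apply: hxy => //; last first.
    by apply/negP => h; apply: yM; exists (n + k)%N.
  by move: xn; apply: fsubsetP; rewrite M_mono // leq_addr.
pose f (k : 'I_(choice.pickle y).+2) : 'I_(choice.pickle y).+1 :=
  inord (choice.pickle (v (n + k).+1)).
have : injective f.
  move=> k k' /(congr1 (@nat_of_ord _)); rewrite /f !inordK ?ltnS //.
  move=> /(pcan_inj choice.pickleK).
  apply: contra_eq; rewrite neq_ltn => /orP[kk'|kk']; last rewrite eq_sym.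
    by apply: v_inj; rewrite ltnS ltn_add2l.
  by apply: v_inj; rewrite ltnS ltn_add2l.
by move=> /leq_card; rewrite !card_ord ltnn.
Qed.

End Tree.

(** * Integration of gradients to height functions *)

Section Heights.
Context {V : countType} {e : rel V} {d : nat}.
Hypothesis tree : cayley_tree e d.
Variable X : exhaustion (e := e).
Local Open Scope fset_scope.
Local Open Scope ring_scope.

Implicit Types (L M : {fset V}) (x y z w : V) (omega : V -> int) (eta : gradient e).

Let e_sym := edge_sym tree.
Let e_irr := edge_irr tree.

Lemma connected_prefix n : connected_fset e (prefix X n).
Proof.
elim: n => [|n IH]; first by rewrite prefix0; exact: connected1.
by rewrite prefixS; apply: (connected_add tree IH (parent_in X n)); exact: parent_edge.
Qed.

Lemma prefix_mono m n : (m <= n)%N -> prefix X m `<=` prefix X n.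
Proof.
move=> /subnKC <-; elim: (n - m)%N => [|k IH]; first by rewrite addn0.
by rewrite addnS prefixS; apply: fsubset_trans IH _; rewrite fsubsetUr.
Qed.

Lemma vertex_in n : vertex X n \in prefix X n.
Proof. by case: n => [|n]; rewrite ?prefix0 ?prefixS !inE eqxx. Qed.

Lemma vertex0_in n : vertex X 0 \in prefix X n.
Proof. exact: (fsubsetP (prefix_mono (leq0n n))) (vertex_in 0). Qed.

Lemma prefix_neq0 n : prefix X n != fset0.
Proof. by apply/fset0Pn; exists (vertex X n); exact: vertex_in. Qed.

Lemma prefix_sup L : exists n, L `<=` prefix X n.
Proof.
have [f fP] := choice (prefix_exhaust X).
exists (\max_(x <- L) f x)%N; apply/fsubsetP => x xL.
by apply: (fsubsetP (prefix_mono _)) (fP x); rewrite (big_rem x) //= leq_maxl.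
Qed.

Lemma eq_gradient eta eta' : (forall x y, eta x y = eta' x y) -> eta = eta'.
Proof.
case: eta eta' => [f fa fo] [g ga go] /= fg.
have {}fg : f = g by apply/funext => x; apply/funext => y; exact: fg.
by subst g; congr Gradient; exact: Prop_irrelevance.
Qed.

Lemma grad_anti omega x y :
  (if e x y then omega y - omega x else 0) =
  - (if e y x then omega x - omega y else 0).
Proof. by rewrite e_sym; case: ifP; rewrite ?oppr0 ?opprB. Qed.

Lemma grad_off omega x y : ~~ e x y -> (if e x y then omega y - omega x else 0) = 0.
Proof. by move/negbTE => ->. Qed.

Definition grad omega : gradient e := Gradient (grad_anti omega) (grad_off omega).

Lemma grad_edge omega x y : e x y -> grad omega x y = omega y - omega x.
Proof. by rewrite /= => ->. Qed.

Lemma gradient_ofP omega eta : gradient_of omega eta <-> eta = grad omega.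
Proof.
split=> [h|-> x y exy]; last by rewrite grad_edge.
apply: eq_gradient => x y /=; case: ifPn => [/h//|]; exact: gradient_off.
Qed.

Fixpoint partial_height eta n : V -> int :=
  if n is m.+1 then
    fun z => if z == vertex X n then
               partial_height eta m (parent X m) + eta (parent X m) (vertex X n)
             else partial_height eta m z
  else fun=> 0.

Lemma partial_heightS eta m n z : (m <= n)%N -> z \in prefix X m ->
  partial_height eta n z = partial_height eta m z.
Proof.
move=> /subnKC <- zm; elim: (n - m)%N => [|k IH]; first by rewrite addn0.
rewrite addnS /=; case: eqP => // zv; have := vertex_new X (m + k).
by rewrite -zv => /negP[]; move: zm; apply: fsubsetP; rewrite prefix_mono ?leq_addr.
Qed.

(** The partial heights of [z] are constant from the first prefix containing [z] on, so the prefix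
    chosen by [cid] is immaterial. The root has height 0. *)
Definition height eta z : int :=
  partial_height eta (projT1 (cid (prefix_exhaust X z))) z.

Lemma heightE eta n z : z \in prefix X n -> height eta z = partial_height eta n z.
Proof.
rewrite /height; case: cid => m /= zm zn.
have [mn|/ltnW nm] := leqP m n; first by rewrite (partial_heightS _ mn).
by rewrite (partial_heightS _ nm).
Qed.

Lemma height_root eta : height eta (vertex X 0) = 0.
Proof. by rewrite (heightE _ (vertex_in 0)). Qed.

Lemma heightS eta n : height eta (vertex X n.+1) =
  height eta (parent X n) + eta (parent X n) (vertex X n.+1).
Proof.
by rewrite (heightE _ (vertex_in n.+1)) /= eqxx (heightE _ (parent_in X n)).
Qed.

Lemma parent_unique n x : x \in prefix X n -> e x (vertex X n.+1) -> x = parent X n.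
Proof.
move=> xn exv; apply: (unique_neighbour tree _ xn (parent_in X n) (vertex_new X n) exv).
  exact: connected_prefix.
exact: parent_edge.
Qed.

(** This is where acyclicity enters: within a prefix the last vertex has no edge except the one to
    its parent, along which its height was defined. *)
Lemma gradient_of_height eta : gradient_of (height eta) eta.
Proof.
suff h n x y : x \in prefix X n -> y \in prefix X n -> e x y ->
    eta x y = height eta y - height eta x.
  move=> x y exy; have [n /fsubsetP h'] := prefix_sup [fset x; y].
  by apply: (h n) => //; apply: h'; rewrite !inE eqxx ?orbT.
elim: n x y => [|n IH] x y.
  by rewrite prefix0 !inE => /eqP -> /eqP ->; rewrite e_irr.
rewrite prefixS !inE => /orP[/eqP->|xn] /orP[/eqP ->|yn].
- by rewrite e_irr.
- rewrite e_sym => /(parent_unique yn) ->.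
  by rewrite heightS opprD addNKr [LHS]gradient_anti.
- by move=> /(parent_unique xn) ->; rewrite heightS addrC addKr.
- exact: IH.
Qed.

Lemma grad_height eta : grad (height eta) = eta.
Proof. by apply/esym/gradient_ofP; exact: gradient_of_height. Qed.

Lemma height_diff_connected L omega omega' : connected_fset e L ->
  (forall x y, x \in L -> y \in L -> e x y -> omega y - omega x = omega' y - omega' x) ->
  forall x y, x \in L -> y \in L -> omega y - omega x = omega' y - omega' x.
Proof.
move=> cL h x y xL yL; have [p [xp pL lp]] := cL _ _ xL yL.
elim: p x xL xp pL lp => [|z p IH] x xL /=; first by move=> _ _ <-; rewrite !subrr.
move=> /andP[exz zp] pL lp; have zL : z \in L by rewrite pL ?inE ?eqxx.
have hz : omega y - omega z = omega' y - omega' z.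
  by apply: IH => // t tp; rewrite pL // inE tp orbT.
by rewrite -(subrKA (omega z) (omega y)) hz h // subrKA.
Qed.

Lemma height_diff omega eta x y : gradient_of omega eta ->
  height eta y - height eta x = omega y - omega x.
Proof.
move=> h; have [n /fsubsetP sub] := prefix_sup [fset x; y].
apply: (@height_diff_connected _ (height eta) omega (@connected_prefix n)).
- by move=> x' y' _ _ exy; rewrite -h // (gradient_of_height eta).
- by apply: sub; rewrite !inE eqxx.
- by apply: sub; rewrite !inE eqxx orbT.
Qed.

Lemma height_grad omega x :
  height (grad omega) x = omega x - omega (vertex X 0).
Proof.
rewrite -[LHS]subr0 -(height_root (grad omega)).
by apply: height_diff; apply/gradient_ofP.
Qed.

(* For connected [S] this is the event that the increments along the edges
   inside [S] are those of [omega]; for [S] disconnected it also records the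
   height differences between the components of [S]. *)
Definition diff_event (S : {fset V}) omega : set (gradient e) :=
  [set eta | forall x y, x \in S -> y \in S ->
     height eta y - height eta x = omega y - omega x].

Lemma diff_event_connected L omega : connected_fset e L ->
  [set eta : gradient e | forall x y, x \in L -> y \in L ->
     eta x y = grad omega x y] = diff_event L omega.
Proof.
move=> cL; apply/seteqP; split => eta h.
  apply: height_diff_connected => // x y xL yL exy.
  by rewrite -(gradient_of_height eta) // h // grad_edge.
move=> x y xL yL; have [exy|exy] := boolP (e x y).
  by rewrite grad_edge // -h // (gradient_of_height eta).
by rewrite !gradient_off.
Qed.

End Heights.

(** * Weights of the boundary law on connected sets *)

Section Products.
Context {V : countType} {e : rel V} {d : nat} {R : comNzRingType}.
Hypothesis tree : cayley_tree e d.
Local Open Scope fset_scope.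
Local Open Scope ring_scope.

Implicit Types (L M : {fset V}) (x y z w : V) (c : rel V) (F : V -> V -> R) (g : V -> R).

Let e_sym := edge_sym tree.
Let e_irr := edge_irr tree.

(** One product over ordered pairs serves both orientations: [edge1] for weights, [away w] for
    transition probabilities. *)
Definition pair_prod c L F : R :=
  \prod_(x <- L) \prod_(y <- L) if c x y then F x y else 1.

Lemma pair_prod1 c w F : c w w = false -> pair_prod c [fset w] F = 1.
Proof. by move=> cw; rewrite /pair_prod !big_seq_fset1 cw. Qed.

Lemma pair_prod_add c L x y F : y \notin L -> x \in L -> c y y = false ->
  (forall t, t \in L -> t != x -> c y t = false /\ c t y = false) ->
  pair_prod c (y |` L) F =
  (if c y x then F y x else 1) * (if c x y then F x y else 1) * pair_prod c L F.
Proof.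
move=> yL xL cyy cx; rewrite {1}/pair_prod big_fsetU1 //=.
rewrite big_fsetU1 //= cyy mul1r.
under [X in _ * X]eq_bigr => z _ do rewrite big_fsetU1 //=.
rewrite big_split /= mulrA; congr (_ * _); congr (_ * _).
  rewrite (big_fsetD1 x) //= big_seq big1 ?mulr1 // => t.
  by rewrite !inE => /andP[tx tL]; have [-> _] := cx t tL tx.
rewrite (big_fsetD1 x) //= big_seq big1 ?mulr1 // => t.
by rewrite !inE => /andP[tx tL]; have [_ ->] := cx t tL tx.
Qed.

Definition edge_prod := pair_prod (edge1 e).

Lemma edge1_irr x : edge1 e x x = false.
Proof. by rewrite /edge1 e_irr. Qed.

Lemma edge1_sym x y : e x y -> edge1 e y x = ~~ edge1 e x y.
Proof.
move=> exy; rewrite /edge1 [e y x]e_sym exy /= -leqNgt ltn_neqAle.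
suff -> : choice.pickle y != choice.pickle x by [].
apply: contraNneq (edge_neq tree exy) => /(pcan_inj choice.pickleK) ->.
by rewrite eqxx.
Qed.

Lemma edge1W x y : edge1 e x y -> e x y. Proof. by case/andP. Qed.

Lemma new_vertex_edges L x y t : connected_fset e L -> x \in L -> y \notin L ->
  e x y -> t \in L -> t != x -> e t y = false.
Proof.
move=> cL xL yL exy tL; apply: contraNF => ety.
by rewrite (unique_neighbour tree cL xL tL yL exy ety).
Qed.

(** Symmetry of [F] on the new edge is required because the codes decide in which direction that
    edge is counted. *)
Lemma edge_prod_add L x y F : connected_fset e L -> x \in L -> y \notin L ->
  e x y -> F x y = F y x -> edge_prod (y |` L) F = F x y * edge_prod L F.
Proof.
move=> cL xL yL exy Fxy; rewrite /edge_prod (pair_prod_add (x := x)) //.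
- rewrite edge1_sym //; case: (edge1 e x y); first by rewrite mul1r.
  by rewrite mulr1 Fxy.
- exact: edge1_irr.
move=> t tL tx; have ety := new_vertex_edges cL xL yL exy tL tx.
by split; rewrite /edge1 ?[e y t]e_sym ety.
Qed.

Lemma away_edge w x y : away e w x y -> e x y.
Proof. by move=> /asboolP[p [+ _ <-]]; rewrite rcons_path => /andP[]. Qed.

Lemma away_new w L x y : connected_fset e L -> w \in L -> x \in L -> y \notin L ->
  e x y -> away e w x y.
Proof.
move=> cL wL xL yL exy; have [p [wp pL lp]] := cL _ _ wL xL.
case/shortenP: wp lp => p' wp' up' sp' lp'.
apply/asboolP; exists p'; split=> //; first by rewrite rcons_path wp' lp'.
rewrite -rcons_cons rcons_uniq up' andbT; apply: contra yL.
by rewrite inE => /orP[/eqP ->//|/sp'/pL].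
Qed.

(* A path from [w] to [y] avoiding [x], together with a path from [x] to [w]
   inside [L], would close a cycle through the edge [(x, y)]. *)
Lemma away_old w L x y t : connected_fset e L -> w \in L -> x \in L -> y \notin L ->
  e x y -> t \in L -> away e w y t = false.
Proof.
move=> cL wL xL yL exy tL; apply/negP => h.
have tx : t = x.
  apply: (unique_neighbour tree cL tL xL yL _ exy).
  by rewrite e_sym; exact: away_edge h.
move: h => /asboolP[p [wp up lp]]; rewrite tx in wp up.
have xw : x != w.
  by move: up; rewrite /= mem_rcons inE negb_or eq_sym => /andP[/andP[]].
have xp : x \notin w :: p by move: up; rewrite -rcons_cons rcons_uniq => /andP[].
have [r [xr rL lr]] := cL _ _ xL wL.
case/shortenP: xr lr => r' xr' ur' sr' lr'.
case: r' xr' ur' sr' lr' => [|z r'] /=; first by move=> _ _ _ wx; rewrite wx eqxx in xw.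
move=> /andP[exz zr'] /andP[xr' _] sr' lr'.
have zL : z \in L by apply: rL; apply: sr'; rewrite inE eqxx.
suff zy : z = y by rewrite -zy zL in yL.
apply: (no_detour tree (p := r' ++ p) exz exy).
- rewrite cat_path zr' lr'; move: wp; rewrite rcons_path => /andP[-> _] //.
- by rewrite last_cat lr'.
rewrite -cat_cons mem_cat negb_or xr' /=.
by move: xp; rewrite inE negb_or => /andP[].
Qed.

Lemma away_irr w x : away e w x x = false.
Proof. by apply/negP => /away_edge; rewrite e_irr. Qed.

Lemma away_prod_add w L x y F : connected_fset e L -> w \in L -> x \in L ->
  y \notin L -> e x y ->
  pair_prod (away e w) (y |` L) F = F x y * pair_prod (away e w) L F.
Proof.
move=> cL wL xL yL exy; rewrite (pair_prod_add (x := x)) //.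
- by rewrite (away_old cL wL xL yL exy xL) mul1r (away_new cL wL xL yL exy).
- exact: away_irr.
move=> t tL tx; split; first exact: (away_old cL wL xL yL exy tL).
apply/negP => /away_edge; by rewrite (new_vertex_edges cL xL yL exy tL tx).
Qed.

Definition outer_degree L x := #|` neighbours (e := e) x `\` L|.

Lemma outer_degree_inner L x : neighbours (e := e) x `<=` L -> outer_degree L x = 0%N.
Proof. by rewrite /outer_degree -fsetD_eq0 => /eqP ->; rewrite cardfs0. Qed.

Lemma outer_degree1 x : outer_degree [fset x] x = d.+1.
Proof.
rewrite /outer_degree -(card_neighbours tree x); congr #|` _|.
apply/fsetP => z; rewrite !inE (in_neighbours tree).
by case: eqP => //= ->; rewrite e_irr.
Qed.

Lemma outer_degree_new L x y : connected_fset e L -> x \in L -> y \notin L ->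
  e x y -> outer_degree (y |` L) y = d.
Proof.
move=> cL xL yL exy; have := card_neighbours tree y.
rewrite (cardfsD1 x) (in_neighbours tree) e_sym exy add1n => -[<-].
congr #|` _|; apply/fsetP => z; rewrite !inE (in_neighbours tree) !negb_or.
have [->|zx] /= := eqVneq z x; first by rewrite xL andbF.
have [->|zy] /= := eqVneq z y; first by rewrite e_irr.
have [zL|//] /= := boolP (z \in L).
by rewrite e_sym (new_vertex_edges cL xL yL exy zL zx).
Qed.

Lemma outer_degree_parent L x y : x \in L -> y \notin L -> e x y ->
  outer_degree L x = (outer_degree (y |` L) x).+1.
Proof.
move=> xL yL exy; rewrite /outer_degree (cardfsD1 y) !inE (in_neighbours tree) exy yL.
by rewrite add1n; congr (#|` _|).+1; apply/fsetP => z; rewrite !inE negb_or andbA.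
Qed.

Lemma outer_degree_other L x y t : connected_fset e L -> x \in L -> y \notin L ->
  e x y -> t \in L -> t != x -> outer_degree (y |` L) t = outer_degree L t.
Proof.
move=> cL xL yL exy tL tx; rewrite /outer_degree; congr #|` _|; apply/fsetP => z.
rewrite !inE (in_neighbours tree) negb_or; have [->|//] := eqVneq z y.
by rewrite (new_vertex_edges cL xL yL exy tL tx) !andbF.
Qed.

Definition spin_prod L g : R := \prod_(x <- L) g x ^+ outer_degree L x.

(** The leaf [y] has [d] outer neighbours and [x] loses one. The factor [g x] stands on the left
    because the coefficients form only a commutative ring. *)
Lemma spin_prod_add L x y g : connected_fset e L -> x \in L -> y \notin L ->
  e x y -> spin_prod (y |` L) g * g x = spin_prod L g * g y ^+ d.
Proof.
move=> cL xL yL exy; rewrite /spin_prod big_fsetU1 //= (outer_degree_new cL xL yL exy).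
rewrite (big_fsetD1 x) //= [in RHS](big_fsetD1 x) //= (outer_degree_parent xL yL exy).
have -> : \prod_(t <- L `\ x) g t ^+ outer_degree L t =
    \prod_(t <- L `\ x) g t ^+ outer_degree (y |` L) t.
  apply: eq_fbigr => t; rewrite !inE => /andP[tx tL] _.
  by rewrite (outer_degree_other cL xL yL exy tL tx).
rewrite exprS; move: (\prod_(t <- _) _) (_ ^+ outer_degree _ _) (g y ^+ d) => a b k.
by rewrite mulrC [k * _]mulrC !mulrA.
Qed.

End Products.

Section CylinderMass.
Context {R : realType} {V : countType} {e : rel V} {d q : nat}.
Variables (Q : int -> R) (U : 'Z_q -> R) (K : R).
Hypothesis tree : cayley_tree e d.
Hypothesis Q_l1 : summable [set: int] (fun i => (Q i)%:E).
Hypothesis Q_gt0 : forall i, 0 < Q i.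
Hypothesis Q_even : forall i, Q (- i) = Q i.
Hypothesis U_gt0 : forall s, 0 < U s.
Hypothesis K_gt0 : 0 < K.
Hypothesis U_eq : forall s, \sum_t Qq Q (s - t) * U t ^+ d = K * U s.
Local Open Scope fset_scope.
Local Open Scope ring_scope.

Implicit Types (L M : {fset V}) (x y z w : V) (omega : V -> int).

Definition total_mass := \sum_s U s ^+ d.+1.

Definition increment_weight omega x y : R := Q (omega x - omega y).

Definition spin_weight L omega s : R :=
  spin_prod (e := e) L (fun x => U (s + (omega x)%:~R)).

(* Probability of the increments of [omega] on the connected set [L]: the
   Gibbs weight of the boundary law, summed over the class of the height
   at one vertex. *)
Definition cyl_mass L omega : R :=
  K / total_mass * K^-1 ^+ #|` L| * edge_prod (e := e) L (increment_weight omega)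
  * \sum_s spin_weight L omega s.

Definition update omega y (k : int) : V -> int := fun z => if z == y then k else omega z.

Lemma total_mass_gt0 : 0 < total_mass.
Proof.
rewrite /total_mass (bigD1 0) //= ltr_pwDl ?exprn_gt0 // sumr_ge0 // => s _.
by rewrite exprn_ge0 // ltW.
Qed.

Lemma pair_prod_gt0 c L (F : V -> V -> R) : (forall x y, 0 < F x y) ->
  0 < pair_prod c L F.
Proof. by move=> F0; rewrite !prodr_gt0 // => x _; rewrite prodr_gt0 // => y _; case: ifP. Qed.

Lemma spin_weight_gt0 L omega s : 0 < spin_weight L omega s.
Proof. by rewrite prodr_gt0 // => x _; rewrite exprn_gt0. Qed.

Lemma sum_spin_gt0 L omega : 0 < \sum_s spin_weight L omega s.
Proof.
rewrite (bigD1 0) //= ltr_pwDl ?spin_weight_gt0 // sumr_ge0 // => s _.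
by rewrite ltW // spin_weight_gt0.
Qed.

Lemma cyl_mass_gt0 L omega : 0 < cyl_mass L omega.
Proof.
rewrite !mulr_gt0 ?invr_gt0 ?exprn_gt0 ?invr_gt0 ?total_mass_gt0 ?sum_spin_gt0 //.
by apply: pair_prod_gt0 => a b; exact: Q_gt0.
Qed.

Lemma eq_pair_prod (c : rel V) L (F G : V -> V -> R) :
  (forall x y, x \in L -> y \in L -> c x y -> F x y = G x y) ->
  pair_prod c L F = pair_prod c L G.
Proof.
move=> FG; apply: eq_big_seq => x xL; apply: eq_big_seq => y yL.
by case: ifP => // /FG ->.
Qed.

Lemma eq_spin_weight L omega omega' s :
  (forall x, x \in L -> omega x = omega' x) ->
  spin_weight L omega s = spin_weight L omega' s.
Proof. by move=> h; apply: eq_big_seq => x xL; rewrite h. Qed.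

Lemma eq_cyl_mass L omega omega' : (forall x, x \in L -> omega x = omega' x) ->
  cyl_mass L omega = cyl_mass L omega'.
Proof.
move=> h; congr (_ * _ * _).
  by apply: eq_pair_prod => x y xL yL _; rewrite /increment_weight !h.
by apply: eq_bigr => s _; exact: eq_spin_weight.
Qed.

(** A global shift is absorbed by translating the summation variable in ['Z_q]; so the mass depends
    on increments only. *)
Lemma cyl_mass_shift L omega (k : int) :
  cyl_mass L (fun x => omega x + k) = cyl_mass L omega.
Proof.
congr (_ * _ * _).
  by apply: eq_pair_prod => x y _ _ _; rewrite /increment_weight opprD addrACA subrr addr0.
rewrite [RHS](reindex_inj (addIr (k%:~R))) /=; apply: eq_bigr => s _.
apply: eq_bigr => x _; congr (U _ ^+ _).
by rewrite rmorphD /= addrA [RHS]addrAC.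
Qed.

Lemma cyl_mass_diff L omega omega' x0 : x0 \in L ->
  (forall x, x \in L -> omega x - omega x0 = omega' x - omega' x0) ->
  cyl_mass L omega = cyl_mass L omega'.
Proof.
move=> x0L h; rewrite -(cyl_mass_shift L omega' (omega x0 - omega' x0)).
apply: eq_cyl_mass => x /h /eqP; rewrite subr_eq => /eqP ->.
by rewrite addrA addrAC.
Qed.

Lemma cyl_mass1 x omega : cyl_mass [fset x] omega = 1.
Proof.
rewrite /cyl_mass cardfs1 expr1 /edge_prod (pair_prod1 _ (edge1_irr tree x)) mulr1.
have -> : \sum_s spin_weight [fset x] omega s = total_mass.
  rewrite /total_mass [RHS](reindex_inj (addIr ((omega x)%:~R))) /=.
  apply: eq_bigr => s _; rewrite /spin_weight /spin_prod big_seq_fset1.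
  by rewrite (outer_degree1 tree).
by field; rewrite !gt_eqF ?total_mass_gt0.
Qed.

Lemma spin_weight_add L x y omega s : connected_fset e L -> x \in L -> y \notin L ->
  e x y -> spin_weight (y |` L) omega s =
  spin_weight L omega s * (U (s + (omega y)%:~R) ^+ d / U (s + (omega x)%:~R)).
Proof.
move=> cL xL yL exy; have h := spin_prod_add tree (fun z => U (s + (omega z)%:~R)) cL xL yL exy.
by rewrite mulrA -h mulfK // gt_eqF.
Qed.

Lemma edge_prod_increment_add L x y omega : connected_fset e L -> x \in L ->
  y \notin L -> e x y ->
  edge_prod (e := e) (y |` L) (increment_weight omega) =
  Q (omega x - omega y) * edge_prod (e := e) L (increment_weight omega).
Proof.
move=> cL xL yL exy; rewrite (edge_prod_add tree cL xL yL exy) //.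
by rewrite /increment_weight -Q_even opprB.
Qed.

(** The leaf multiplies the term of [s] by [Q (omega x - k) U(s + k)^d / (K U(s + omega x))]. Summed
    over [k] the numerator is, by the equation for [U] at [s + omega x], exactly the denominator. *)
Lemma cyl_mass_leaf L x y omega : connected_fset e L -> x \in L -> y \notin L ->
  e x y ->
  (\esum_(k in [set: int]) (cyl_mass (y |` L) (update omega y k))%:E =
   (cyl_mass L omega)%:E)%E.
Proof.
move=> cL xL yL exy.
have upL z k : z \in L -> update omega y k z = omega z.
  by move=> zL; rewrite /update; case: eqP => // zy; rewrite -zy zL in yL.
have upy k : update omega y k y = k by rewrite /update eqxx.
pose c s := K / total_mass * K^-1 ^+ #|` L|.+1 *
  edge_prod (e := e) L (increment_weight omega) *
  (spin_weight L omega s / U (s + (omega x)%:~R)).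
have c0 s : 0 <= c s.
  apply: ltW; rewrite !mulr_gt0 ?invr_gt0 ?exprn_gt0 ?invr_gt0 ?total_mass_gt0 //.
    by apply: pair_prod_gt0 => a b; exact: Q_gt0.
  exact: spin_weight_gt0.
have massE k : cyl_mass (y |` L) (update omega y k) =
    \sum_s c s * (Q (omega x - k) * U (s + k%:~R) ^+ d).
  rewrite /cyl_mass (edge_prod_increment_add _ cL xL yL exy) upy (upL x) //.
  rewrite cardfsU1 yL add1n mulr_sumr; apply: eq_bigr => s _.
  rewrite (spin_weight_add _ _ cL xL yL exy) upy (upL x) //.
  have -> : edge_prod (e := e) L (increment_weight (update omega y k)) =
            edge_prod (e := e) L (increment_weight omega).
    by apply: eq_pair_prod => a b aL bL _; rewrite /increment_weight !upL.
  rewrite (@eq_spin_weight L (update omega y k) omega) => [|z zL]; last exact: upL.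
  by rewrite /c; ring.
under eq_esum => k _ do rewrite massE -sumEFin.
rewrite esum_sum; last first.
  move=> k s _ _; rewrite lee_fin; apply: mulr_ge0; first exact: c0.
  by apply: mulr_ge0; [exact: ltW|rewrite exprn_ge0 // ltW].
under eq_bigr => s _.
  under eq_esum => k _ do rewrite EFinM.
  rewrite esumZl //; last by move=> k; rewrite lee_fin mulr_ge0 ?exprn_ge0 // ltW.
  rewrite (@esum_periodise _ Q q Q_l1 Q_gt0 (fun t => U (s + t) ^+ d)); last first.
    by move=> t; rewrite exprn_ge0 // ltW.
  (* Translating by [s] brings the sum over classes to the left side of [U_eq] at [s + omega x]. *)
  rewrite (reindex_inj (addrI (- s))) /=.
  under eq_bigr => t _ do rewrite addNKr opprD opprK addrA.
  rewrite [_ + s]addrC U_eq -EFinM; over.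
rewrite sumEFin; congr (_%:E); rewrite /cyl_mass mulr_sumr; apply: eq_bigr => s _.
by rewrite /c exprS; field; rewrite !gt_eqF ?total_mass_gt0.
Qed.

End CylinderMass.

(** * The gradient measure *)

Section LebesgueImage.
Context {R : realType} {disp : measure_display} {T : measurableType disp}.
Variables (D : set (measurableTypeR R)) (f : measurableTypeR R -> T).
Hypothesis mD : measurable D.
Hypothesis D1 : lebesgue_measure D = 1%E.
Hypothesis mf : measurable_fun [set: measurableTypeR R] f.

Definition lebesgue_image (A : set T) : \bar R :=
  lebesgue_measure (f @^-1` A `&` D).

Let mpre A : measurable A -> measurable (f @^-1` A).
Proof. by move=> mA; rewrite -[X in measurable X]setTI; exact: mf. Qed.

Let lebesgue_image0 : lebesgue_image set0 = 0%E.
Proof. by rewrite /lebesgue_image preimage_set0 set0I measure0. Qed.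

Let lebesgue_image_ge0 A : (0 <= lebesgue_image A)%E.
Proof. exact: measure_ge0. Qed.

Let lebesgue_image_sigma_additive : semi_sigma_additive lebesgue_image.
Proof.
move=> F mF tF mUF; rewrite /lebesgue_image preimage_bigcup setI_bigcupl.
apply: measure_semi_sigma_additive.
- by move=> n; apply: measurableI => //; exact: mpre.
- apply/trivIsetP => /= i j _ _ ij; rewrite setIACA -preimage_setI.
  by move/trivIsetP : tF => /(_ _ _ _ _ ij) ->//; rewrite preimage_set0 set0I.
- by rewrite -setI_bigcupl -preimage_bigcup; apply: measurableI => //; exact: mpre.
Qed.

HB.instance Definition _ := isMeasure.Build _ _ _ lebesgue_image
  lebesgue_image0 lebesgue_image_ge0 lebesgue_image_sigma_additive.

Let lebesgue_imageT : lebesgue_image setT = 1%E.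
Proof. by rewrite /lebesgue_image preimage_setT setTI. Qed.

HB.instance Definition _ :=
  Measure_isProbability.Build _ _ _ lebesgue_image lebesgue_imageT.

Lemma ex_lebesgue_image : exists nu : probability T R,
  forall A, nu A = lebesgue_measure (f @^-1` A `&` D).
Proof. by exists lebesgue_image. Qed.

End LebesgueImage.

(** * Coding of heights by lists and generating families of events *)

Section GradientSpace.
Context {V : countType} {e : rel V} {d : nat}.
Hypothesis tree : cayley_tree e d.
Variable X : exhaustion (e := e).
Local Open Scope fset_scope.
Local Open Scope ring_scope.

Implicit Types (L M : {fset V}) (x y z w : V) (omega : V -> int).

(** A list of length [n], latest entry first, gives the heights of vertices 1 to [n]; the root has
    height 0 and is not listed. *)
Fixpoint heights_of (s : seq int) : V -> int :=
  if s is k :: s' then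
    fun z => if z == vertex X (size s) then k else heights_of s' z
  else fun=> 0.

Fixpoint record_heights omega n : seq int :=
  if n is m.+1 then
    (omega (vertex X n) - omega (vertex X 0)) :: record_heights omega m
  else [::].

Lemma size_record_heights omega n : size (record_heights omega n) = n.
Proof. by elim: n => //= n ->. Qed.

Lemma heights_of_cons k s z : z \in prefix X (size s) ->
  heights_of (k :: s) z = heights_of s z.
Proof.
by move=> zs /=; case: eqP => // zv; have := vertex_new X (size s); rewrite -zv zs.
Qed.

Lemma heights_of_root s : heights_of s (vertex X 0) = 0.
Proof. by elim: s => // k s IH; rewrite heights_of_cons ?vertex0_in. Qed.

Lemma heights_of_record omega n z : z \in prefix X n ->
  heights_of (record_heights omega n) z = omega z - omega (vertex X 0).
Proof.
elim: n => [|n IH]; first by rewrite prefix0 inE => /eqP ->; rewrite subrr.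
rewrite prefixS !inE => /orP[/eqP ->|zn].
  by rewrite /= size_record_heights eqxx.
by rewrite /= size_record_heights; case: eqP => [->//|_]; exact: IH.
Qed.

Lemma heights_of_inj s s' : size s = size s' ->
  (forall z, z \in prefix X (size s) -> heights_of s z = heights_of s' z) -> s = s'.
Proof.
elim: s s' => [|k s IH] [|k' s'] // [ss] h; congr (_ :: _).
  by have := h (vertex X (size s).+1) (vertex_in _ _); rewrite /= -ss eqxx.
apply: IH => // z zs; rewrite -(heights_of_cons k zs) h.
  by rewrite heights_of_cons // -ss.
by move: zs; apply: fsubsetP; rewrite prefix_mono.
Qed.

Lemma record_heights_of s n : size s = n -> record_heights (heights_of s) n = s.
Proof.
move=> sn; apply: heights_of_inj; rewrite size_record_heights // => z zn.
by rewrite heights_of_record // heights_of_root subr0.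
Qed.

Lemma diff_event_prefix n omega (eta : gradient e) :
  diff_event X (prefix X n) omega eta <->
  record_heights (height X eta) n = record_heights omega n.
Proof.
split => [h|h x y xn yn].
  apply: heights_of_inj; rewrite !size_record_heights // => z zn.
  by rewrite !heights_of_record //; apply: h => //; exact: vertex0_in.
have hz z : z \in prefix X n ->
    height X eta z - height X eta (vertex X 0) = omega z - omega (vertex X 0).
  by move=> zn; rewrite -!(heights_of_record _ zn) h.
have -> : height X eta y - height X eta x =
    (height X eta y - height X eta (vertex X 0)) -
    (height X eta x - height X eta (vertex X 0)) by ring.
by rewrite !hz //; ring.
Qed.

Lemma record_height_grad omega n :
  record_heights (height X (grad tree omega)) n = record_heights omega n.
Proof.
apply/diff_event_prefix => x y _ _.
by rewrite !height_grad opprB addrA subrK.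
Qed.

(** The bound [n0] permits restricting to prefixes that surround a given finite set without losing
    the generated sigma-algebra. The empty set is added to obtain stability under intersection. *)
Definition prefix_events n0 : set (set (gradient e)) :=
  [set A | A = set0 \/
     exists n omega, (n0 <= n)%N /\ A = diff_event X (prefix X n) omega].

Lemma diff_event_sub (S S' : {fset V}) omega :
  S `<=` S' -> (diff_event X S' omega `<=` diff_event X S omega)%classic.
Proof. by move=> /fsubsetP SS' eta h x y xS yS; apply: h; exact: SS'. Qed.

(** Two such events are either disjoint or nested, the one with the longer prefix being contained in
    the other. *)
Lemma prefix_events_setI n0 : setI_closed (prefix_events n0).
Proof.
suff h n m omega omega' : (n0 <= n)%N -> (n <= m)%N -> prefix_events n0
    (diff_event X (prefix X n) omega `&` diff_event X (prefix X m) omega')%classic.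
  move=> A B [->|[n [omega [n0n ->]]]]; first by left; rewrite set0I.
  move=> [->|[m [omega' [n0m ->]]]]; first by left; rewrite setI0.
  have [nm|/ltnW mn] := leqP n m; first exact: h.
  by rewrite setIC; exact: h.
move=> n0n nm; have [->|/set0P[eta [h1 h2]]] := eqVneq
  (diff_event X (prefix X n) omega `&` diff_event X (prefix X m) omega')%classic set0.
  by left.
right; exists m, omega'; split; first exact: leq_trans nm.
apply/setIidPr => eta' h x y xn yn; rewrite -h1 //.
have sub := fsubsetP (prefix_mono X nm).
by rewrite h ?sub // h2 ?sub.
Qed.

(** There are only countably many lists of integers, so every event decided by finitely many heights
    is a countable union of prefix events; measurability follows. *)
Lemma determined_union n (A : set (gradient e)) :
  (forall eta eta', record_heights (height X eta) n = record_heights (height X eta') n ->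
     A eta -> A eta') ->
  A = \bigcup_(s : seq int)
        (if (size s == n) && `[< A (grad tree (heights_of s)) >]
         then diff_event X (prefix X n) (heights_of s) else set0).
Proof.
move=> hA; apply/seteqP; split => [eta Aeta|eta [s _]].
  exists (record_heights (height X eta) n) => //.
  rewrite size_record_heights eqxx /= ifT.
    by apply/diff_event_prefix; rewrite record_heights_of ?size_record_heights.
  apply/asboolP; apply: hA Aeta; rewrite record_height_grad.
  by rewrite record_heights_of ?size_record_heights.
case: ifP => // /andP[/eqP sn /asboolP As] /diff_event_prefix h.
by apply: hA As; rewrite record_height_grad h.
Qed.

Lemma cylinder_determined x y k : exists n0, forall n eta eta', (n0 <= n)%N ->
  record_heights (height X eta) n = record_heights (height X eta') n ->
  eta x y = k -> (eta' : gradient e) x y = k.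
Proof.
have [n0 /fsubsetP sub] := prefix_sup X [fset x; y].
exists n0 => n eta eta' n0n /diff_event_prefix h <-.
have [exy|exy] := boolP (e x y); last by rewrite !gradient_off.
rewrite !(gradient_of_height tree X) //; apply/esym/h.
  by apply: (fsubsetP (prefix_mono X n0n)); apply: sub; rewrite !inE eqxx.
by apply: (fsubsetP (prefix_mono X n0n)); apply: sub; rewrite !inE eqxx orbT.
Qed.

Lemma measurable_diff_connected L omega : connected_fset e L ->
  measurable (diff_event X L omega : set (grad_space e)).
Proof.
move=> cL; rewrite -(diff_event_connected tree) //.
rewrite (_ : [set _ | _] = \bigcap_(x in [set` L]) \bigcap_(y in [set` L])
   [set eta : gradient e | eta x y = grad tree omega x y]); last first.
  by apply/seteqP; split => eta h x xL; [move=> y yL; exact: h|move=> y yL; exact: (h x)].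
apply: fin_bigcap_measurable => [|x _]; first exact: finite_fset.
apply: fin_bigcap_measurable => [|y _]; first exact: finite_fset.
by apply: sub_sigma_algebra; exists x, y, (grad tree omega x y).
Qed.

Lemma measurable_determined n (A : set (gradient e)) :
  (forall eta eta', record_heights (height X eta) n = record_heights (height X eta') n ->
     A eta -> A eta') -> measurable (A : set (grad_space e)).
Proof.
move=> /determined_union ->; apply: countable_bigcupT_measurable => //.
move=> s; case: ifP => // _; apply: measurable_diff_connected.
exact: (connected_prefix tree).
Qed.

Lemma measurable_prefix_events n0 :
  @measurable _ (grad_space e) = <<s prefix_events n0 >>.
Proof.
apply/seteqP; split; last first.
  apply: smallest_sub; first exact: sigma_algebra_measurable.
  move=> A [->|[n [omega [_ ->]]]]; first exact: measurable0.
  by apply: measurable_diff_connected; exact: (connected_prefix tree).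
apply: smallest_sub; first exact: smallest_sigma_algebra.
move=> A [x [y [k ->]]]; have [m hm] := cylinder_determined x y k.
set n := maxn n0 m.
rewrite (@determined_union n [set eta : gradient e | eta x y = k]); last first.
  by move=> eta eta' h /=; apply: hm h; rewrite leq_maxr.
apply: (@countable_bigcupT_measurable _ (g_sigma_algebraType (prefix_events n0))) => //.
move=> s; case: ifP => // _; apply: sub_sigma_algebra; right.
by exists n, (heights_of s); rewrite leq_maxl.
Qed.

End GradientSpace.

Section GradientMeasure.
Context {R : realType} {V : countType} {e : rel V} {d q : nat}.
Variables (Q : int -> R) (U : 'Z_q -> R) (K : R).
Hypothesis tree : cayley_tree e d.
Variable X : exhaustion (e := e).
Hypothesis Q_l1 : summable [set: int] (fun i => (Q i)%:E).
Hypothesis Q_gt0 : forall i, 0 < Q i.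
Hypothesis Q_even : forall i, Q (- i) = Q i.
Hypothesis U_gt0 : forall s, 0 < U s.
Hypothesis K_gt0 : 0 < K.
Hypothesis U_eq : forall s, \sum_t Qq Q (s - t) * U t ^+ d = K * U s.
Local Open Scope ring_scope.

Implicit Types (L M : {fset V}) (x y z w : V) (omega : V -> int).

Notation mass := (cyl_mass (e := e) (d := d) Q U K).

Let p (s : seq int) : R := mass (prefix X (size s)) (heights_of X s).

Let p_ge0 s : 0 <= p s.
Proof. by apply: ltW; exact: cyl_mass_gt0. Qed.

Let p_nil : p [::] = 1.
Proof. by rewrite /p /= prefix0; exact: (cyl_mass1 _ tree). Qed.

Let p_cons s : (\esum_(k in [set: int]) (p (k :: s))%:E = (p s)%:E)%E.
Proof.
rewrite /p -(cyl_mass_leaf tree Q_l1 Q_gt0 Q_even U_gt0 K_gt0 U_eq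
  (heights_of X s) (@connected_prefix _ _ _ tree X (size s)) (parent_in X (size s))
  (vertex_new X (size s)) (parent_edge X (size s))).
by rewrite /= prefixS.
Qed.

Let hist := history 0 p.
Let unit_itv : set R := `[0, 1[%classic.

Let size_hist r n : size (hist r n) = n.
Proof. by elim: n => //= n ->. Qed.

Let hist_height r m n z : (m <= n)%N -> z \in prefix X m ->
  heights_of X (hist r n) z = heights_of X (hist r m) z.
Proof.
move=> /subnKC <- zm; elim: (n - m)%N => [|k IH]; first by rewrite addn0.
rewrite addnS [hist r (m + k).+1]/= heights_of_cons // size_hist.
by apply: (fsubsetP (prefix_mono X _)) zm; rewrite leq_addr.
Qed.

Let random_height (r : R) z : int :=
  heights_of X (hist r (projT1 (cid (prefix_exhaust X z)))) z.

Let random_heightE r n z : z \in prefix X n ->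
  random_height r z = heights_of X (hist r n) z.
Proof.
rewrite /random_height; case: cid => m /= zm zn.
have [mn|/ltnW nm] := leqP m n; first by rewrite (hist_height _ mn).
by rewrite (hist_height _ nm).
Qed.

Let record_random r n : record_heights X (random_height r) n = hist r n.
Proof.
apply: (heights_of_inj (X := X)); rewrite size_record_heights ?size_hist // => z zn.
rewrite heights_of_record // (random_heightE _ zn).
by rewrite (random_heightE _ (vertex0_in X n)) heights_of_root subr0.
Qed.

Let random_gradient (r : measurableTypeR R) : grad_space e :=
  if `[< unit_itv r >] then grad tree (random_height r) else gradient0 e.

Let random_determined n (A : set (gradient e)) :
  (forall eta eta', record_heights X (height X eta) n = record_heights X (height X eta') n ->
     A eta -> A eta') ->
  random_gradient @^-1` A `&` unit_itv =
  \bigcup_(s : seq int)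
    (if (size s == n) && `[< A (grad tree (heights_of X s)) >]
     then history_interval p s else set0).
Proof.
move=> hA; apply/seteqP; split => [r [/=]|r [s _]].
  rewrite /random_gradient => + ur; rewrite asboolT // => Ar.
  exists (hist r n) => //; rewrite size_hist eqxx /= ifT.
    rewrite -(history_event 0 p_ge0 p_nil p_cons); split => //=.
    by rewrite size_hist.
  apply/asboolP; apply: hA Ar.
  by rewrite !record_height_grad record_random record_heights_of // size_hist.
case: ifP => // /andP[/eqP sn /asboolP As].
rewrite -(history_event 0 p_ge0 p_nil p_cons) => -[ur /= hs]; split => //=.
rewrite /random_gradient asboolT //; apply: hA As.
by rewrite !record_height_grad record_random record_heights_of // -hs -sn.
Qed.

Let measurable_unit : measurable (unit_itv : set (measurableTypeR R)).
Proof. exact: measurable_itv. Qed.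

Let measurable_random : measurable_fun [set: measurableTypeR R] random_gradient.
Proof.
refine (@measurability _ _ (measurableTypeR R) (grad_space e) setT
  random_gradient (cylinders e) _ _) => //.
move=> _ [_ [x [y [k ->]] <-]]; rewrite setTI.
have [n hn] := cylinder_determined tree X x y k.
(* Inside the unit interval the preimage is a countable union of history intervals; outside it the
   map is constant. *)
rewrite -[X in measurable X]setIT -(setUv unit_itv) setIUr; apply: measurableU.
  rewrite (@random_determined n); last by move=> eta eta' h; exact: (hn n).
  apply: countable_bigcupT_measurable => // s; case: ifP => // _.
  exact: measurable_itv.
have [g0|g0] := pselect (gradient0 e x y = k).
  rewrite (_ : _ `&` _ = ~` unit_itv)%classic; first exact: measurableC.
  apply/seteqP; split => [r []//|r ur]; split => //=.
  by rewrite /random_gradient asboolF.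
rewrite (_ : _ `&` _ = set0)%classic; first exact: measurable0.
apply/seteqP; split => [r [/= + ur]|//]; rewrite /random_gradient asboolF //.
Qed.

Lemma ex_gradient_measure : exists nu : probability (grad_space e) R,
  forall n omega, nu (diff_event X (prefix X n) omega) = (mass (prefix X n) omega)%:E.
Proof.
have [|nu nuE] := ex_lebesgue_image measurable_unit _ measurable_random.
  by rewrite lebesgue_measure_itv /= lte_fin ltr01 oppr0 adde0.
exists nu => n omega; rewrite nuE.
set s := record_heights X omega n.
have -> : random_gradient @^-1` diff_event X (prefix X n) omega `&` unit_itv =
          history_interval p s.
  rewrite -(history_event 0 p_ge0 p_nil p_cons) setIC size_record_heights.
  apply/seteqP; split => r [ur /= h]; split => //=.
    move: h; rewrite /random_gradient asboolT // => /diff_event_prefix.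
    by rewrite record_height_grad record_random.
  rewrite /random_gradient asboolT //; apply/diff_event_prefix.
  by rewrite record_height_grad record_random.
rewrite (lebesgue_history p_ge0) /p size_record_heights; congr (_%:E).
apply: cyl_mass_diff; first exact: (vertex0_in X n).
by move=> x xn; rewrite heights_of_record // heights_of_root subr0.
Qed.

End GradientMeasure.

(** * Marginals on connected sets and on edges *)

Section Marginals.
Context {R : realType} {V : countType} {e : rel V} {d q : nat}.
Variables (Q : int -> R) (U : 'Z_q -> R) (K : R).
Hypothesis tree : cayley_tree e d.
Variable X : exhaustion (e := e).
Hypothesis Q_l1 : summable [set: int] (fun i => (Q i)%:E).
Hypothesis Q_gt0 : forall i, 0 < Q i.
Hypothesis Q_even : forall i, Q (- i) = Q i.
Hypothesis U_gt0 : forall s, 0 < U s.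
Hypothesis K_gt0 : 0 < K.
Hypothesis U_eq : forall s, \sum_t Qq Q (s - t) * U t ^+ d = K * U s.

Notation mass := (cyl_mass (e := e) (d := d) Q U K).

Variable nu : probability (grad_space e) R.
Hypothesis nu_prefix : forall n omega,
  nu (diff_event X (prefix X n) omega) = (mass (prefix X n) omega)%:E.

Local Open Scope fset_scope.
Local Open Scope ring_scope.
Implicit Types (L M : {fset V}) (x y z w : V) (omega : V -> int).

Lemma diff_event_split L x y omega : x \in L -> y \notin L ->
  diff_event X L omega = \bigcup_(k : int) diff_event (e := e) X (y |` L) (update omega y k).
Proof.
move=> xL yL.
have upL z k : z \in L -> update omega y k z = omega z.
  by move=> zL; rewrite /update; case: eqP => // zy; rewrite -zy zL in yL.
apply/seteqP; split => [eta h|eta [k _] h a b aL bL]; last first.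
  by rewrite -(upL a k) // -(upL b k) // h // !inE ?aL ?bL orbT.
exists (height X eta y - height X eta x + omega x) => //.
set k := _ + _; have kE z : z \in y |` L ->
    update omega y k z = height X eta z - height X eta x + omega x.
  rewrite !inE => /orP[/eqP ->|zL]; first by rewrite /update eqxx.
  by rewrite upL // (h x z) // subrK.
by move=> a b /kE -> /kE ->; ring.
Qed.

(** The induction predicate on [M] is an implication, from the formula on [M] to the formula on [L].
    Growing [M] up to a prefix therefore means removing leaves, each time by countable additivity
    and [cyl_mass_leaf]. *)
Lemma nu_connected L omega : connected_fset e L -> L != fset0 ->
  nu (diff_event X L omega) = (mass L omega)%:E.
Proof.
move=> cL L0; have [n Ln] := prefix_sup X L.
move: omega; apply: (growth_ind tree (P := fun M => (forall omega,
  nu (diff_event X M omega) = (mass M omega)%:E) ->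
  forall omega, nu (diff_event X L omega) = (mass L omega)%:E)
  cL L0 (@connected_prefix _ _ _ tree X n) Ln) => //.
move=> N x y LN cN xN yN exy IH h; apply: IH => omega.
rewrite (diff_event_split _ xN yN) measure_countable_bigcup.
- rewrite -(cyl_mass_leaf tree Q_l1 Q_gt0 Q_even U_gt0 K_gt0 U_eq _ cN xN yN exy).
  by apply: eq_esum => k _; exact: h.
- move=> k; apply: (measurable_diff_connected tree); exact: (connected_add tree cN xN exy).
move=> i j eta /(_ x y) hi /(_ x y) hj.
have xy : x != y by apply: contraTneq xN => ->.
move: hi hj; rewrite !inE xN eqxx orbT => /(_ isT isT) -> /(_ isT isT).
by rewrite /update eqxx (negbTE xy) => /addIr.
Qed.

Lemma nu_increments L (zeta : gradient e) : connected_fset e L -> L != fset0 ->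
  nu [set eta : gradient e | forall x y, x \in L -> y \in L -> eta x y = zeta x y] =
  (mass L (height X zeta))%:E.
Proof.
move=> cL L0; rewrite -(nu_connected _ cL L0) -(diff_event_connected tree) //.
by rewrite grad_height.
Qed.

(** Each end of an edge has [d] neighbours off the edge, whence the two [d]-th powers. *)
Lemma nu_edge x y (k : int) : e x y ->
  nu [set eta : gradient e | eta x y = k] =
  (K / total_mass (d := d) U * K^-1 ^+ 2 * Q k *
   \sum_s U s ^+ d * U (s + k%:~R) ^+ d)%:E.
Proof.
move=> exy; have xy := edge_neq tree exy.
have c1 := @connected1 V e x.
have cxy := connected_add tree c1 (fset11 x) exy.
have yx : y \notin [fset x] by rewrite inE eq_sym.
pose omega := update (fun=> 0) y k : V -> int.
have omx : omega x = 0 by rewrite /omega /update (negbTE xy).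
have omy : omega y = k by rewrite /omega /update eqxx.
have -> : [set eta : gradient e | eta x y = k] = diff_event X (y |` [fset x]) omega.
  rewrite -(diff_event_connected tree) //; apply/seteqP; split => eta /= h.
    move=> a b; rewrite !inE => /orP[] /eqP -> /orP[] /eqP ->.
    - by rewrite !(edge_irr tree) gradient_off ?(edge_irr tree).
    - by rewrite (edge_sym tree) exy omx omy gradient_anti h sub0r.
    - by rewrite exy omx omy h subr0.
    - by rewrite !(edge_irr tree) gradient_off ?(edge_irr tree).
  by rewrite h ?inE ?eqxx ?orbT // exy omx omy subr0.
rewrite nu_connected //; last by apply/fset0Pn; exists x; rewrite !inE eqxx orbT.
rewrite /cyl_mass cardfsU1 yx cardfs1.
rewrite (edge_prod_increment_add tree Q_even _ c1 (fset11 x) yx exy) //.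
rewrite /edge_prod (pair_prod1 _ (edge1_irr tree x)) mulr1 omx omy sub0r Q_even.
congr (_ * _)%:E; apply: eq_bigr => s _.
rewrite (spin_weight_add tree U_gt0 _ _ c1 (fset11 x) yx exy) omx omy addr0.
rewrite /spin_weight /spin_prod big_seq_fset1 (outer_degree1 tree) omx addr0 exprS.
by field; rewrite gt_eqF.
Qed.

Lemma nu_not_free : (0 < d)%N -> (exists s, U (s + 1) != U s) -> ~ is_free_state Q nu.
Proof.
move=> d0 [s Us] free; pose x := vertex X 0; pose y := vertex X 1.
have exy : e x y.
  have := parent_edge X 0; have := parent_in X 0.
  by rewrite prefix0 inE => /eqP ->.
(* The free state is described along [edge1], which may reverse the edge from [x] to [y]. In that
   case the increment 1 becomes -1, with the same weight since [Q] is even. *)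
have [a [b [c [eab /= cQ evE]]]] : exists a b (c : int), [/\ edge1 e a b, Q c = Q 1 &
    [set eta : gradient e | eta a b = c] = [set eta | eta x y = 1] /\
    [set eta : gradient e | eta a b = 0] = [set eta | eta x y = 0] ].
  have [exy1|exy1] := boolP (edge1 e x y); first by exists x, y, 1.
  exists y, x, (-1); split; rewrite ?Q_even //; first by rewrite (edge1_sym tree exy).
  split; apply/seteqP; split => eta /=; rewrite (gradient_anti eta y x).
  - by move/oppr_inj.
  - by move=> ->.
  - by move/eqP; rewrite oppr_eq0 => /eqP.
  - by move=> ->; rewrite oppr0.
have fr k : nu [set eta : gradient e | eta a b = k] =
    (Q k / lp_norm 1 [set: int] Q)%:E.
  have := free [fset (a, b)] (fun=> k); rewrite big_seq_fset1 => <-.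
    congr (nu _); apply/seteqP; split => eta /= h; first by move=> p; rewrite inE => /eqP ->.
    by apply: (h (a, b)); rewrite inE.
  by move=> p; rewrite inE => /eqP ->.
have h0 := fr 0; have h1 := fr c; rewrite evE.1 nu_edge // cQ in h1.
rewrite evE.2 nu_edge // in h0.
set C := _ * _ ^+ 2 in h0 h1.
have C0 : 0 < C by rewrite !mulr_gt0 ?exprn_gt0 ?invr_gt0 ?total_mass_gt0.
have eqsum : \sum_s U s ^+ d * U (s + 0%:~R) ^+ d = \sum_s U s ^+ d * U (s + 1%:~R) ^+ d.
  have e0 := EFin_inj h0; have e1 := EFin_inj h1.
  have Q00 := lt0r_neq0 (Q_gt0 0); have Q10 := lt0r_neq0 (Q_gt0 1).
  apply: (mulfI (lt0r_neq0 C0)).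
  apply: (mulfI Q00); rewrite mulrA [Q 0 * C]mulrC e0.
  apply: (mulfI Q10); rewrite [RHS]mulrCA [Q 1 * (C * _)]mulrA [Q 1 * C]mulrC e1.
  by rewrite mulrCA.
pose f s := U s ^+ d.
(* Equality case of Cauchy-Schwarz for [U ^ d] and its translate, written as a vanishing sum of
   squares. *)
have sq : \sum_s (f (s + 1) - f s) ^+ 2 = 0.
  have -> : \sum_s (f (s + 1) - f s) ^+ 2 =
      \sum_s f (s + 1) ^+ 2 + \sum_s f s ^+ 2 - 2 * \sum_s f s * f (s + 1).
    rewrite mulr_sumr -big_split -sumrB /=; apply: eq_bigr => t _; ring.
  have -> : \sum_s f (s + 1) ^+ 2 = \sum_s f s ^+ 2.
    by rewrite [RHS](reindex_inj (addIr 1)).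
  have -> : \sum_s f s * f (s + 1) = \sum_s f s ^+ 2.
    by rewrite -eqsum; apply: eq_bigr => t _; rewrite addr0 expr2.
  ring.
have /allP/(_ s) : all (fun s => (f (s + 1) - f s) ^+ 2 == 0) (index_enum 'Z_q).
  by have /eqP := sq; rewrite psumr_eq0 // => t _; rewrite sqr_ge0.
rewrite mem_index_enum => /(_ isT); rewrite sqrf_eq0 subr_eq0 => /eqP fs.
move/eqP: Us; apply.
by have := @pexpIrn R d d0 (U (s + 1)) (U s); apply; rewrite ?nnegrE ?ltW.
Qed.

End Marginals.

(** * Invariance under tree automorphisms *)

Section Invariance.
Context {R : realType} {V : countType} {e : rel V} {d q : nat}.
Variables (Q : int -> R) (U : 'Z_q -> R) (K : R).
Hypothesis tree : cayley_tree e d.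
Variable X : exhaustion (e := e).
Hypothesis Q_l1 : summable [set: int] (fun i => (Q i)%:E).
Hypothesis Q_gt0 : forall i, 0 < Q i.
Hypothesis Q_even : forall i, Q (- i) = Q i.
Hypothesis U_gt0 : forall s, 0 < U s.
Hypothesis K_gt0 : 0 < K.
Hypothesis U_eq : forall s, \sum_t Qq Q (s - t) * U t ^+ d = K * U s.

Notation mass := (cyl_mass (e := e) (d := d) Q U K).

Variable nu : probability (grad_space e) R.
Hypothesis nu_prefix : forall n omega,
  nu (diff_event X (prefix X n) omega) = (mass (prefix X n) omega)%:E.

Local Open Scope fset_scope.
Local Open Scope ring_scope.
Implicit Types (L M : {fset V}) (x y z w : V) (omega : V -> int).

Variables (phi psi : V -> V).
Hypothesis phiK : cancel phi psi.
Hypothesis psiK : cancel psi phi.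
Hypothesis phi_edge : {mono phi : x y / e x y}.

Let phi_inj : injective phi := can_inj phiK.
Let image L := [fset phi x | x in L].

Lemma mem_image_aut L x : (phi x \in image L) = (x \in L).
Proof. by rewrite mem_imfset. Qed.

Lemma image_autP L z : z \in image L -> exists2 x, x \in L & z = phi x.
Proof. by move=> /imfsetP[x /= xL ->]; exists x. Qed.

Lemma connected_image_aut L : connected_fset e L -> connected_fset e (image L).
Proof.
move=> cL a b /image_autP[x xL ->] /image_autP[y yL ->].
have [p [xp pL lp]] := cL _ _ xL yL; exists (map phi p); split.
- by rewrite path_map (eq_path (e' := e)).
- by move=> z /mapP[t tp ->]; rewrite mem_image_aut pL.
- by rewrite last_map lp.
Qed.

Lemma outer_degree_image_aut L x :
  outer_degree (e := e) (image L) (phi x) = outer_degree (e := e) L x.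
Proof.
rewrite /outer_degree.
transitivity #|` image (neighbours (e := e) x `\` L)|; last by rewrite card_imfset.
congr #|` _|; apply/fsetP => z; rewrite -(psiK z) mem_image_aut !inE.
by rewrite mem_image_aut !(in_neighbours tree) phi_edge.
Qed.

(** An automorphism need not respect the orientation given by the codes, so the product cannot
    simply be reindexed; growing the set leaf by leaf uses only the symmetry of the edge factor. *)
Lemma edge_prod_image_aut L omega : connected_fset e L -> L != fset0 ->
  edge_prod (e := e) (image L) (increment_weight Q (omega \o psi)) =
  edge_prod (e := e) L (increment_weight Q omega).
Proof.
move=> cL /fset0Pn[x0 x0L].
have im1 x : image [fset x] = [fset phi x].
  by apply/fsetP => z; rewrite -(psiK z) mem_image_aut !inE (inj_eq phi_inj).
apply: (growth_ind tree (P := fun M =>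
  edge_prod (e := e) (image M) (increment_weight Q (omega \o psi)) =
  edge_prod (e := e) M (increment_weight Q omega)) (@connected1 V e x0) _ cL).
- by apply/fset0Pn; exists x0; rewrite inE.
- by rewrite fsub1set.
- by rewrite im1 /edge_prod !pair_prod1 // (edge1_irr tree).
move=> N x y _ cN xN yN exy IH.
have -> : image (y |` N) = phi y |` image N.
  by apply/fsetP => z; rewrite -(psiK z) mem_image_aut !inE mem_image_aut (inj_eq phi_inj).
rewrite (edge_prod_increment_add tree Q_even _ (connected_image_aut cN)
  (x := phi x)) ?mem_image_aut ?phi_edge //.
by rewrite (edge_prod_increment_add tree Q_even _ cN xN yN exy) IH /= !phiK.
Qed.

Lemma mass_image_aut L omega : connected_fset e L -> L != fset0 ->
  mass (image L) (omega \o psi) = mass L omega.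
Proof.
move=> cL L0; rewrite /cyl_mass edge_prod_image_aut // card_imfset //.
congr (_ * _); apply: eq_bigr => s _.
rewrite /spin_weight /spin_prod /image big_imfset /=; last by move=> a b _ _ /phi_inj.
by apply: eq_bigr => x _; rewrite phiK outer_degree_image_aut.
Qed.

Lemma diff_event_relabel L omega (aut : automorphism e phi) : connected_fset e L ->
  relabel aut @^-1` diff_event X L omega = diff_event X (image L) (omega \o psi).
Proof.
move=> cL; rewrite -(diff_event_connected tree) //.
rewrite -(diff_event_connected tree); last exact: connected_image_aut.
apply/seteqP; split => eta /= h.
  move=> a b /image_autP[x xL ->] /image_autP[y yL ->].
  by rewrite phi_edge !phiK; exact: h.
by move=> x y xL yL; rewrite h ?mem_image_aut // phi_edge !phiK.
Qed.

(** By a pi-lambda argument prefix events suffice. The image of a prefix is in general no prefix,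
    only a connected set, which is why the marginals are required on all connected sets. *)
Lemma nu_relabel (aut : automorphism e phi) (A : set (grad_space e)) :
  measurable A -> nu (relabel aut @^-1` A) = nu A.
Proof.
pose r : grad_space e -> grad_space e := relabel aut.
have mr : measurable_fun [set: grad_space e] r.
  refine (@measurability _ _ (grad_space e) (grad_space e) setT r (cylinders e) _ _) => //.
  move=> _ [_ [x [y [k ->]] <-]]; rewrite setTI.
  by apply: sub_sigma_algebra; exists (phi x), (phi y), k.
have mpre B : measurable B -> measurable (r @^-1` B).
  by move=> mB; rewrite -[X in measurable X]setTI; exact: mr.
rewrite -[relabel aut]/r.
rewrite (measurable_prefix_events tree X 0); move: A.
apply: (dynkin_induction (measurable_prefix_events tree X 0)).
- exact: prefix_events_setI.
- by rewrite preimage_setT.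
- move=> A [->|[n [omega [_ ->]]]]; first by rewrite preimage_set0.
  have cn := @connected_prefix _ _ _ tree X n.
  rewrite diff_event_relabel // (nu_connected tree Q_l1 Q_gt0 Q_even U_gt0 K_gt0 U_eq nu_prefix).
  + by rewrite mass_image_aut ?prefix_neq0 // nu_prefix.
  + exact: connected_image_aut.
  + apply/fset0Pn; exists (phi (vertex X n)).
    by rewrite mem_image_aut vertex_in.
- move=> A mA hA; rewrite preimage_setC !probability_setC //; last exact: mpre.
  by rewrite hA.
move=> F mF tF hF; rewrite preimage_bigcup !measure_semi_bigcup //.
- by apply: eq_eseriesr => n _; exact: hF.
- exact: bigcupT_measurable.
- by move=> n; exact: mpre.
- move=> i j _ _ [x [/= xi xj]]; apply: (tF i j) => //; by exists (r x).
- by apply: bigcupT_measurable => n; exact: mpre.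
Qed.

End Invariance.

(** * The fuzzy chain *)

Section FuzzyChain.
Context {R : realType} {V : countType} {e : rel V} {d q : nat}.
Variables (Q : int -> R) (U : 'Z_q -> R) (K : R).
Hypothesis tree : cayley_tree e d.
Hypothesis q_ge2 : (2 <= q)%N.
Hypothesis d_gt0 : (0 < d)%N.
Hypothesis Q_l1 : summable [set: int] (fun i => (Q i)%:E).
Hypothesis Q_gt0 : forall i, 0 < Q i.
Hypothesis Q_even : forall i, Q (- i) = Q i.
Hypothesis U_gt0 : forall s, 0 < U s.
Hypothesis K_gt0 : 0 < K.
Hypothesis U_eq : forall s, \sum_t Qq Q (s - t) * U t ^+ d = K * U s.

Definition law_of (i : int) : R := U i%:~R ^+ d.

Lemma on_Zq_law_of s : on_Zq law_of s = U s ^+ d.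
Proof. by rewrite /on_Zq /law_of Zq_surj. Qed.

Lemma law_of_periodic_boundary_law : periodic_boundary_law d Q q law_of.
Proof.
split=> [i|i|].
- by rewrite exprn_gt0.
- have q0 : (q%:Z)%:~R = 0 :> 'Z_q by rewrite -pmulrn pchar_Zp.
  by rewrite /law_of rmorphD /= q0 addr0.
(* The equation for [U] raised to the power [d] reads [(K U)^d = K^d lam]. *)
exists (K^-1 ^+ d); first by rewrite exprn_gt0 ?invr_gt0.
move=> i; rewrite (@rsum_periodise R Q q Q_l1 Q_gt0 (fun t => U t ^+ d)); last first.
  by move=> t; rewrite exprn_ge0 // ltW.
by rewrite U_eq -exprMn mulKf ?gt_eqF.
Qed.

Lemma fuzzy_alphaE s :
  fuzzy_alpha d law_of s = U s ^+ d.+1 / total_mass (d := d) U.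
Proof.
have pw t : on_Zq law_of t `^ (d.+1%:R / d%:R) = U t ^+ d.+1.
  rewrite on_Zq_law_of -powR_mulrn ?ltW // -powRrM mulrC divfK ?pnatr_eq0 ?gtn_eqF //.
  by rewrite powR_mulrn ?ltW.
by rewrite /fuzzy_alpha pw /total_mass; congr (_ / _); apply: eq_bigr => t _.
Qed.

Lemma fuzzy_PE s t :
  fuzzy_P Q law_of s t = Qq Q (s - t) * U t ^+ d / (K * U s).
Proof.
rewrite /fuzzy_P on_Zq_law_of -U_eq; congr (_ / _).
by apply: eq_bigr => r _; rewrite on_Zq_law_of.
Qed.

Local Open Scope fset_scope.
Local Open Scope ring_scope.
Implicit Types (L M : {fset V}) (x y z w : V) (omega : V -> int).

Notation mass := (cyl_mass (e := e) (d := d) Q U K).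

Lemma prod_pairE L (c : rel V) (F : V -> V -> R) :
  \prod_(p : L * L | c (val p.1) (val p.2)) F (val p.1) (val p.2) = pair_prod c L F.
Proof.
rewrite big_mkcond /= -(pair_big predT predT (fun a b : L =>
  if c (val a) (val b) then F (val a) (val b) else 1)) /=.
rewrite /pair_prod big_seq_fsetE; apply: eq_bigr => a _.
by rewrite [RHS]big_seq_fsetE.
Qed.

Lemma rho_sym (zeta : gradient e) x y (s : 'Z_q) :
  rho Q (zeta y x) (- s) = rho Q (zeta x y) s.
Proof. by rewrite gradient_anti /rho rmorphN /= eqr_opp Q_even Qq_even. Qed.

(** Growing from the root, each new edge contributes a transition probability times [rho]: the
    factors [Qq] cancel and [Q U(sigma y)^d / (K U(sigma x))] remains, as in the unrooted weight. *)
Lemma fuzzy_chain_weight L w omega (t : 'Z_q) (zeta : gradient e) :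
  gradient_of omega zeta -> connected_fset e L -> w \in L ->
  let sigma x := t + (omega x)%:~R in
  fuzzy_alpha d law_of (sigma w) *
  pair_prod (away e w) L (fun x y => fuzzy_P Q law_of (sigma x) (sigma y)) *
  edge_prod (e := e) L (fun x y => rho Q (zeta x y) (sigma y - sigma x)) =
  K / total_mass (d := d) U * K^-1 ^+ #|` L| *
  edge_prod (e := e) L (increment_weight Q omega) * spin_weight (e := e) U L omega t.
Proof.
move=> ozeta cL wL sigma.
have T0 := total_mass_gt0 (d := d) U_gt0.
pose P M := w \in M -> fuzzy_alpha d law_of (sigma w) *
  pair_prod (away e w) M (fun x y => fuzzy_P Q law_of (sigma x) (sigma y)) *
  edge_prod (e := e) M (fun x y => rho Q (zeta x y) (sigma y - sigma x)) =
  K / total_mass (d := d) U * K^-1 ^+ #|` M| *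
  edge_prod (e := e) M (increment_weight Q omega) * spin_weight (e := e) U M omega t.
suff : P L by apply.
apply: (growth_ind tree (P := P) (@connected1 V e w) _ cL).
- by apply/fset0Pn; exists w; rewrite inE.
- by rewrite fsub1set.
- move=> _; rewrite /edge_prod !pair_prod1 ?(edge1_irr tree) ?(away_irr tree) //.
  rewrite cardfs1 fuzzy_alphaE /spin_weight /spin_prod big_seq_fset1 (outer_degree1 tree).
  by field; rewrite !gt_eqF.
move=> N x y wN cN xN yN exy IH _.
have {wN}wN : w \in N by rewrite -fsub1set.
rewrite (away_prod_add tree _ cN wN xN yN exy).
rewrite (edge_prod_add tree cN xN yN exy); last by rewrite -opprB rho_sym.
rewrite (edge_prod_increment_add tree Q_even _ cN xN yN exy).
rewrite (spin_weight_add tree U_gt0 _ _ cN xN yN exy) -/(sigma x) -/(sigma y).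
rewrite cardfsU1 yN add1n exprS fuzzy_PE /rho ozeta //.
have -> : ((omega y - omega x)%:~R == sigma y - sigma x :> 'Z_q).
  by rewrite /sigma rmorphB /=; apply/eqP; ring.
have := IH wN.
set A := fuzzy_alpha _ _ _; set B := pair_prod _ _ _; set C := edge_prod _ _.
set D := edge_prod _ _; set S := spin_weight _ _ _ _ => IHN.
rewrite -[Q (omega y - omega x)]Q_even opprB -[Qq Q (sigma y - _)]Qq_even // opprB.
set g := Qq Q _.
have g0 : 0 < g by exact: Qq_gt0.
transitivity (A * B * C * (Q (omega x - omega y) * U (sigma y) ^+ d / (K * U (sigma x)))).
  by field; rewrite !gt_eqF.
by rewrite IHN; field; rewrite !gt_eqF.
Qed.

(** A factor [rho] vanishes unless the class increments are those of [omega] modulo [q]. On a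
    connected set only the configurations [t + omega] survive, one for each class [t]. *)
Lemma fuzzy_sum L (w : L) (zeta : gradient e) omega : gradient_of omega zeta ->
  connected_fset e L ->
  \sum_(s : {ffun L -> 'Z_q}) fuzzy_chain d Q e law_of w s *
    \prod_(p : L * L | edge1 e (val p.1) (val p.2))
      rho Q (zeta (val p.1) (val p.2)) (s p.2 - s p.1) = mass L omega.
Proof.
move=> ozeta cL.
rewrite (partition_big (fun s : {ffun L -> 'Z_q} => s w - (omega (val w))%:~R) predT) //=.
rewrite /cyl_mass mulr_sumr; apply: eq_bigr => t _.
pose st : {ffun L -> 'Z_q} := [ffun x => t + (omega (val x))%:~R].
rewrite (bigD1 st) /=; last by rewrite ffunE addrK.
rewrite [X in _ + X]big1 ?addr0.
  rewrite -(fuzzy_chain_weight t ozeta cL (valP w)) /= /fuzzy_chain ffunE.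
  rewrite /edge_prod -!prod_pairE.
  congr (_ * _ * _); apply: eq_bigr => p _; rewrite !ffunE //.
move=> s /andP[/eqP sw sst]; apply/eqP; rewrite mulf_eq0; apply/orP; right.
apply: contraNT sst => /prodf_neq0 h; apply/eqP/ffunP => x; rewrite ffunE.
have edge (a b : L) : e (val a) (val b) ->
    s b - s a = (omega (val b))%:~R - (omega (val a))%:~R.
  have half (a' b' : L) : edge1 e (val a') (val b') ->
      s b' - s a' = (omega (val b'))%:~R - (omega (val a'))%:~R.
    move=> eab; have := h (a', b') eab; rewrite /= /rho.
    case: (_ =P s b' - s a') => [<- _|_]; last by rewrite eqxx.
    by rewrite ozeta ?rmorphB //; exact: edge1W eab.
  move=> eab; have [/half//|] := boolP (edge1 e (val a) (val b)).
  by rewrite -(edge1_sym tree eab) => /half ba; rewrite -opprB ba opprB.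
suff : s x - (omega (val x))%:~R = s w - (omega (val w))%:~R.
  by rewrite sw => /eqP; rewrite subr_eq => /eqP.
have [p [wp pL lp]] := cL _ _ (valP w) (valP x).
suff h' (a b : L) p' : path.path e (val a) p' -> {subset p' <= L} ->
    last (val a) p' = val b ->
    s b - (omega (val b))%:~R = s a - (omega (val a))%:~R by exact: h' wp pL lp.
elim: p' a => [|z p' IH] a /=; first by move=> _ _ /val_inj ->.
move=> /andP[eaz zp'] p'L lzb; have zL : z \in L by rewrite p'L // inE eqxx.
rewrite (IH [` zL]) //; last by move=> r rp; rewrite p'L // inE rp orbT.
have := edge a [` zL] eaz; move=> /eqP; rewrite subr_eq => /eqP ->.
by ring.
Qed.

End FuzzyChain.

(** * The Gibbs property *)

Section GibbsWeights.
Context {R : realType} {V : countType} {e : rel V} {d q : nat}.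
Variables (Q : int -> R) (U : 'Z_q -> R) (K : R).
Hypothesis tree : cayley_tree e d.
Variable X : exhaustion (e := e).
Hypothesis Q_gt0 : forall i, 0 < Q i.

Notation mass := (cyl_mass (e := e) (d := d) Q U K).

Variable nu : probability (grad_space e) R.
Hypothesis nu_prefix : forall n omega,
  nu (diff_event X (prefix X n) omega) = (mass (prefix X n) omega)%:E.

Local Open Scope fset_scope.
Local Open Scope ring_scope.
Implicit Types (M : {fset V}) (x y z w : V) (omega sigma : V -> int) (eta : gradient e).

Variable L : {fset V}.

Notation weight := (gibbs_weight Q e L).

Definition touches x y := (x \in L) || (y \in L).

Definition surrounds M := forall x, x \in L -> x \in M /\ neighbours (e := e) x `<=` M.

Lemma pair_prodID (c b : rel V) M (F : V -> V -> R) : pair_prod c M F =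
  pair_prod (fun x y => c x y && b x y) M F *
  pair_prod (fun x y => c x y && ~~ b x y) M F.
Proof.
rewrite /pair_prod -big_split /=; apply: eq_bigr => x _.
rewrite -big_split /=; apply: eq_bigr => y _.
by case: (c x y); case: (b x y); rewrite /= ?mulr1 ?mul1r.
Qed.

Lemma gibbs_weightE M omega : surrounds M -> weight omega =
  pair_prod (fun x y => edge1 e x y && touches x y) M (increment_weight Q omega).
Proof.
move=> sM.
pose r := [seq p <- [seq (x, y) | x <- M, y <- M] |
             edge1 e p.1 p.2 && touches p.1 p.2].
have ur : uniq r.
  by rewrite filter_uniq // allpairs_uniq ?fset_uniq // => -[? ?] [? ?].
rewrite /gibbs_weight (_ : [set p | _] = [set` r]).
  rewrite -fsbig_seq // big_filter big_mkcond big_allpairs /=.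
  by apply: eq_bigr => x _; apply: eq_bigr => y _.
apply/seteqP; split => -[x y] /=; rewrite mem_filter /=; last first.
  by move=> /andP[/andP[]].
move=> [exy tL]; rewrite exy /touches tL /=.
apply/allpairsP; exists (x, y); split => //=.
  move: tL => /orP[/sM[]//|/sM[_ /fsubsetP]]; apply.
  by rewrite (in_neighbours tree) (edge_sym tree) (edge1W exy).
move: tL => /orP[/sM[_ /fsubsetP]|/sM[]//]; apply.
by rewrite (in_neighbours tree) (edge1W exy).
Qed.

(** The vertex [b] off [L] is the reference that fixes the additive constant when heights off [L]
    are known only up to a shift. *)
Lemma ex_surrounds : exists n0 b, b \notin L /\
  forall n, (n0 <= n)%N -> surrounds (prefix X n) /\ b \in prefix X n.
Proof.
have [b bL] : exists b, b \notin L.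
  have [->|L0] := eqVneq L fset0; first by exists (vertex X 0); rewrite inE.
  by have [x [y [_ yL _]]] := fset_exit tree L0; exists y.
have [f fP] := choice (fun x => prefix_sup X (x |` neighbours (e := e) x)).
exists (\max_(x <- b |` L) f x)%N, b; split => // n.
move=> hn; have hx x : x \in b |` L -> x |` neighbours (e := e) x `<=` prefix X n.
  move=> xL; apply: fsubset_trans (fP x) _; apply: prefix_mono.
  by apply: leq_trans hn; rewrite (big_rem x) //= leq_maxl.
split=> [x xL|]; last by apply: (fsubsetP (hx b _)); rewrite !inE eqxx.
have {hx}hx := hx x; rewrite !inE xL orbT in hx.
split; first by apply: (fsubsetP (hx isT)); rewrite !inE eqxx.
by apply: fsubset_trans (hx isT); rewrite fsubsetUr.
Qed.

Lemma gibbs_weight_gt0 omega : 0 < weight omega.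
Proof.
have [n0 [b [_ h]]] := ex_surrounds; have [sM _] := h n0 (leqnn _).
by rewrite (gibbs_weightE _ sM); apply: pair_prod_gt0 => x y; exact: Q_gt0.
Qed.

Lemma gibbs_weight_shift omega (k : int) :
  weight (fun x => omega x + k) = weight omega.
Proof.
rewrite /gibbs_weight; apply: eq_fsbigr => p _.
by rewrite opprD addrACA subrr addr0.
Qed.

(** Edges not touching [L] have equal factors on both sides, and vertices of [L] have outer degree 0
    in [M]. So the quotient of mass by Gibbs weight depends only on the heights off [L]. *)
Lemma mass_weight_ratio M omega sigma : surrounds M ->
  (forall x, x \in M -> x \notin L -> sigma x = omega x) ->
  mass M sigma * weight omega = mass M omega * weight sigma.
Proof.
move=> sM so; rewrite !(gibbs_weightE _ sM) /cyl_mass /edge_prod.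
rewrite !(pair_prodID (edge1 e) touches M).
have -> : pair_prod (fun x y => edge1 e x y && ~~ touches x y) M (increment_weight Q sigma) =
    pair_prod (fun x y => edge1 e x y && ~~ touches x y) M (increment_weight Q omega).
  apply: eq_pair_prod => x y xM yM /andP[_]; rewrite negb_or => /andP[xL yL].
  by rewrite /increment_weight !so.
have -> : \sum_s spin_weight (e := e) U M sigma s = \sum_s spin_weight (e := e) U M omega s.
  apply: eq_bigr => s _; apply: eq_big_seq => x xM.
  have [xL|xL] := boolP (x \in L); last by rewrite so.
  by rewrite outer_degree_inner ?expr0 //; case: (sM x xL).
by ring.
Qed.

Definition extensions omega : set (V -> int) :=
  [set sigma | forall x, x \notin L -> sigma x = omega x].

(** Parametrises the extensions of [omega] by the countable type [{ffun L -> int}], so that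
    countable additivity applies. *)
Definition glue omega (f : {ffun L -> int}) : V -> int :=
  fun x => if insub x is Some x' then f x' else omega x.

Lemma glue_in omega f (x : L) : glue omega f (val x) = f x.
Proof. by rewrite /glue valK. Qed.

Lemma glue_out omega f x : x \notin L -> glue omega f x = omega x.
Proof. by move=> xL; rewrite /glue insubN. Qed.

Lemma glue_bij omega :
  set_bij [set: {ffun L -> int}] (extensions omega) (glue omega).
Proof.
split => /=.
- by move=> f _ x; exact: glue_out.
- by move=> f g _ _ fg; apply/ffunP => x; rewrite -!(glue_in omega) fg.
- move=> sigma so; exists [ffun x : L => sigma (val x)] => //.
  apply/funext => x; have [xL|xL] := boolP (x \in L); last by rewrite glue_out ?so.
  by rewrite -[x]/(val [` xL]) glue_in ffunE.
Qed.

Section Surrounding.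
Variables (n : nat) (b : V).
Hypothesis sM : surrounds (prefix X n).
Hypothesis bL : b \notin L.
Hypothesis bM : b \in prefix X n.

Let M := prefix X n.
Let b_out : b \in M `\` L. Proof. by rewrite inE bL. Qed.

Lemma outer_event_split omega :
  diff_event X (M `\` L) omega =
  \bigcup_(f : {ffun L -> int}) diff_event (e := e) X M (glue omega f).
Proof.
apply/seteqP; split => [eta h|eta [f _] h x y].
  (* The heights of [eta] on [L], shifted so that [eta] and [omega] agree at [b]. *)
  pose f := [ffun x : L => height X eta (val x) + (omega b - height X eta b)].
  exists f => // x y xM yM.
  have gE z : z \in M -> glue omega f z = height X eta z + (omega b - height X eta b).
    move=> zM; have [zL|zL] := boolP (z \in L).
      by rewrite -[z]/(val [` zL]) glue_in ffunE.
    have zML : z \in M `\` L by rewrite inE zL.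
    rewrite glue_out // -(subrK (omega b) (omega z)) -(h b z b_out zML).
    by ring.
  by rewrite !gE //; ring.
rewrite !inE => /andP[xL xM] /andP[yL yM].
by rewrite (h x y) // !glue_out.
Qed.

Lemma nu_outer omega : nu (diff_event X (M `\` L) omega) =
  (\esum_(sigma in extensions omega) (mass M sigma)%:E)%E.
Proof.
rewrite outer_event_split measure_countable_bigcup.
- rewrite (reindex_esum _ _ _ _ (glue_bij omega)).
  by apply: eq_esum => f _; exact: nu_prefix.
- move=> f; apply: (measurable_diff_connected tree); exact: (connected_prefix tree).
move=> f g eta hf hg; apply/ffunP => x; have [xM _] := sM (valP x).
have := hg b _ bM xM; rewrite (hf b _ bM xM) !glue_in !glue_out //.
by move/addIr.
Qed.

End Surrounding.

End GibbsWeights.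

(** * The Gibbs kernel and its partition function *)

Section GibbsKernel.
Context {R : realType} {V : countType} {e : rel V} {d q : nat}.
Variables (Q : int -> R) (U : 'Z_q -> R) (K : R).
Hypothesis tree : cayley_tree e d.
Variable X : exhaustion (e := e).
Hypothesis Q_gt0 : forall i, 0 < Q i.
Hypothesis U_gt0 : forall s, 0 < U s.
Hypothesis K_gt0 : 0 < K.

Notation mass := (cyl_mass (e := e) (d := d) Q U K).

Variable nu : probability (grad_space e) R.
Hypothesis nu_prefix : forall n omega,
  nu (diff_event X (prefix X n) omega) = (mass (prefix X n) omega)%:E.

Variable L : {fset V}.

Local Open Scope ring_scope.
Implicit Types (M : {fset V}) (x y z w : V) (omega sigma : V -> int) (eta : gradient e).

Notation weight := (gibbs_weight Q e L).
Notation extensions := (extensions L).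
Notation kernel := (@gibbs_kernel R Q V e L).

Let mass_gt0 M omega : 0 < mass M omega. Proof. exact: cyl_mass_gt0. Qed.
Let weight_gt0 omega : 0 < weight omega. Proof. exact: (gibbs_weight_gt0 tree X). Qed.

Let partition omega : R := rsum (extensions omega) weight.

(** Summing the constant ratio of weight to mass over all extensions expresses the partition
    function by the probability of an outer event. It is therefore finite, which matters because
    [rsum] reads a divergent sum as 0. *)
Lemma esum_weight n b omega : surrounds (e := e) L (prefix X n) -> b \notin L ->
  b \in prefix X n ->
  (\esum_(sigma in extensions omega) (weight sigma)%:E =
   (weight omega / mass (prefix X n) omega)%:E *
   nu (diff_event X (prefix X n `\` L)%fset omega))%E.
Proof.
move=> sM bL bM; rewrite (nu_outer tree nu_prefix sM bL bM) -esumZl.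
- apply: eq_esum => sigma so; rewrite -EFinM; congr (_%:E).
  have := mass_weight_ratio Q U K tree sM (fun x _ => so x).
  by move=> h; field: h; rewrite gt_eqF.
- by rewrite divr_ge0 // ltW.
- by move=> sigma; rewrite lee_fin ltW.
Qed.

Let nu_fin (A : set (grad_space e)) : measurable A -> (fine (nu A))%:E = nu A.
Proof. by move=> mA; rewrite fineK // fin_num_measure. Qed.

Lemma measurable_diff_event (S : {fset V}) omega :
  measurable (diff_event X S omega : set (grad_space e)).
Proof.
have [n /fsubsetP Sn] := prefix_sup X S.
apply: (@measurable_determined _ _ _ tree X n) => eta eta' /diff_event_prefix h hS x y xS yS.
by rewrite -hS // h ?Sn.
Qed.

Lemma partitionE n b omega : surrounds (e := e) L (prefix X n) -> b \notin L ->
  b \in prefix X n -> partition omega = weight omega / mass (prefix X n) omega *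
    fine (nu (diff_event X (prefix X n `\` L)%fset omega)).
Proof.
move=> sM bL bM; rewrite /partition /rsum (esum_weight _ sM bL bM).
rewrite -[X in (_ * X)%E]nu_fin ?fineM //; exact: measurable_diff_event.
Qed.

Lemma nu_outer_gt0 n omega :
  0 < fine (nu (diff_event X (prefix X n `\` L)%fset omega)).
Proof.
rewrite -lte_fin nu_fin; last exact: measurable_diff_event.
apply: lt_le_trans (_ : nu (diff_event X (prefix X n) omega) <= _)%E.
  by rewrite nu_prefix lte_fin.
apply: le_measure; rewrite ?inE; try exact: measurable_diff_event.
by apply: diff_event_sub; rewrite fsubsetDl.
Qed.

Let esum_fin omega : (\esum_(sigma in extensions omega) (weight sigma)%:E)%E \is a fin_num.
Proof.
have [n0 [b [bL h]]] := ex_surrounds tree X L; have [sM bM] := h n0 (leqnn _).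
rewrite (esum_weight _ sM bL bM) -nu_fin -?EFinM //; exact: measurable_diff_event.
Qed.

Lemma partition_gt0 omega : 0 < partition omega.
Proof.
have [n0 [b [bL h]]] := ex_surrounds tree X L; have [sM bM] := h n0 (leqnn _).
by rewrite (partitionE _ sM bL bM) !mulr_gt0 ?invr_gt0 ?nu_outer_gt0.
Qed.

Lemma kernelE omega (A : set (gradient e)) : ((kernel omega A)%:E =
  \esum_(sigma in extensions omega `&` [set sigma | A (grad tree sigma)])
     (weight sigma / partition omega)%:E)%E.
Proof.
rewrite /gibbs_kernel -/extensions -/(partition omega).
rewrite (_ : [set sigma | exists2 eta, A eta & gradient_of sigma eta] =
             [set sigma | A (grad tree sigma)]); last first.
  apply/seteqP; split => sigma /=; first by move=> [eta Aeta /(gradient_ofP tree) <-].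
  by move=> As; exists (grad tree sigma) => //; apply/(gradient_ofP tree).
rewrite mulrC EFinM /rsum fineK.
  rewrite -esumZl ?invr_ge0 ?(ltW (partition_gt0 _)) //.
    by apply: eq_esum => sigma _; rewrite -EFinM mulrC.
  by move=> sigma; rewrite lee_fin ltW.
rewrite ge0_fin_numE; last by apply: esum_ge0 => sigma _; rewrite lee_fin ltW.
apply: le_lt_trans (_ : \esum_(sigma in extensions omega) (weight sigma)%:E < _)%E.
  by apply: esum_le_subset => [sigma|sigma []//]; rewrite lee_fin ltW.
by rewrite ltey_eq esum_fin.
Qed.

Let term_ge0 omega sigma : (0 <= (weight sigma / partition omega)%:E)%E.
Proof. by rewrite lee_fin divr_ge0 // ltW // partition_gt0. Qed.

Lemma kernel_ge0 omega A : 0 <= kernel omega A.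
Proof. by rewrite -lee_fin kernelE esum_ge0. Qed.

Lemma kernelT omega : kernel omega setT = 1.
Proof.
rewrite /gibbs_kernel (_ : _ `&` _ = extensions omega).
  by rewrite divff // gt_eqF // partition_gt0.
apply/seteqP; split => [sigma []//|sigma so]; split => //=.
by exists (grad tree sigma) => //; apply/(gradient_ofP tree).
Qed.

Lemma kernelC omega A : kernel omega (~` A) = 1 - kernel omega A.
Proof.
rewrite -(kernelT omega); apply/eqP; rewrite -subr_eq opprK -eqe EFinD.
rewrite !kernelE [X in _ == X](esumID [set sigma | A (grad tree sigma)]) //.
by rewrite addeC -!setIA !setTI.
Qed.

Lemma kernel_bigcup omega (F : nat -> set (gradient e)) : trivIset setT F ->
  ((kernel omega (\bigcup_n F n))%:E = \sum_(0 <= n <oo) (kernel omega (F n))%:E)%E.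
Proof.
move=> tF; rewrite kernelE.
rewrite (_ : _ `&` _ =
   \bigcup_n (extensions omega `&` [set sigma | F n (grad tree sigma)])); last first.
  by rewrite -setI_bigcupr.
rewrite nneseries_sum_bigcup //.
  by apply: eq_eseriesr => n _; rewrite kernelE.
move=> i j _ _ [sigma [/= [_ Fi] [_ Fj]]]; apply: (tF i j) => //.
by exists (grad tree sigma).
Qed.

(** Translation by [k] is a bijection between the two sets of extensions that preserves weights and
    gradients. So the kernel depends only on height differences off [L]. *)
Lemma kernel_shift omega omega' (k : int) A :
  (forall x, x \notin L -> omega x = omega' x + k) -> kernel omega A = kernel omega' A.
Proof.
move=> h; rewrite /gibbs_kernel -/extensions.
have gradD sigma : grad tree (fun x => sigma x + k) = grad tree sigma.
  by apply: eq_gradient => x y /=; case: ifP => // _; rewrite opprD addrACA subrr addr0.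
have bij (P : set (V -> int)) : (forall sigma, P (fun x => sigma x + k) = P sigma) ->
    set_bij (extensions omega' `&` P) (extensions omega `&` P) (fun sigma x => sigma x + k).
  move=> hP; split => /=.
  - by move=> sigma [so Ps]; split; rewrite /= ?hP // => x xL; rewrite so // h.
  - by move=> f g _ _ fg; apply/funext => x; have := congr1 (@^~ x) fg; move/addIr.
  - move=> sigma [so Ps]; exists (fun x => sigma x - k).
      split; first by move=> x xL; rewrite so // h // addrK.
      by rewrite /= -hP (_ : (fun x => _) = sigma) //; apply/funext => x; rewrite subrK.
    by apply/funext => x; rewrite subrK.
have sumE (P : set (V -> int)) : (forall sigma, P (fun x => sigma x + k) = P sigma) ->
    rsum (extensions omega `&` P) weight = rsum (extensions omega' `&` P) weight.
  move=> hP; rewrite /rsum (reindex_esum _ _ _ _ (bij P hP)); congr fine.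
  by apply: eq_esum => sigma _; rewrite gibbs_weight_shift.
rewrite sumE; last first.
  move=> sigma; apply/propext; split => -[eta Aeta /(gradient_ofP tree) etaE];
    exists eta => //; apply/(gradient_ofP tree).
    by rewrite etaE gradD.
  by rewrite etaE gradD.
by have := sumE setT (fun=> erefl); rewrite !setIT => ->.
Qed.

End GibbsKernel.

(** * The kernel as a conditional probability *)

Section GibbsProperty.
Context {R : realType} {V : countType} {e : rel V} {d q : nat}.
Variables (Q : int -> R) (U : 'Z_q -> R) (K : R).
Hypothesis tree : cayley_tree e d.
Variable X : exhaustion (e := e).
Hypothesis Q_gt0 : forall i, 0 < Q i.
Hypothesis U_gt0 : forall s, 0 < U s.
Hypothesis K_gt0 : 0 < K.

Notation mass := (cyl_mass (e := e) (d := d) Q U K).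

Variable nu : probability (grad_space e) R.
Hypothesis nu_prefix : forall n omega,
  nu (diff_event X (prefix X n) omega) = (mass (prefix X n) omega)%:E.

Variable L : {fset V}.

Local Open Scope ring_scope.
Implicit Types (M : {fset V}) (x y z w : V) (omega sigma : V -> int) (eta : gradient e).

Notation weight := (gibbs_weight Q e L).
Notation extensions := (extensions L).
Notation kernel := (@gibbs_kernel R Q V e L).

Let mass_gt0 M omega : 0 < mass M omega. Proof. exact: cyl_mass_gt0. Qed.

(** At most one extension realises the given increments on the prefix, and its normalised weight is
    the elementary conditional probability given the outer part of the event. *)
Lemma kernel_prefix n b omega eta : surrounds (e := e) L (prefix X n) ->
  b \notin L -> b \in prefix X n ->
  kernel (height X eta) (diff_event X (prefix X n) omega) =
  mass (prefix X n) omega / fine (nu (diff_event X (prefix X n `\` L)%fset omega)) *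
  \1_(diff_event X (prefix X n `\` L)%fset omega) eta.
Proof.
move=> sM bL bM; set M := prefix X n; rewrite indicE.
have bML : b \in (M `\` L)%fset by rewrite inE bL.
have inML x : x \notin L -> x \in M -> x \in (M `\` L)%fset by rewrite inE => -> ->.
have [/set_mem heta|neta] := boolP (eta \in _); last first.
  rewrite mulr0; apply: EFin_inj.
  rewrite (kernelE tree Q_gt0 U_gt0 K_gt0 nu_prefix) esum1 //.
  move=> sigma [so /= hs]; exfalso; move: neta; rewrite notin_setE; apply.
  move=> x y; rewrite !inE => /andP[xL xM] /andP[yL yM].
  by rewrite -(hs x y xM yM) !height_grad (so x xL) (so y yL); ring.
rewrite mulr1.
pose k := omega b - height X eta b.
(* Equal to [omega] on [M] and, off [L], a translate of the height of [eta]; it is then the only one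
   of its own extensions lying in the event. *)
pose omega1 z := if z \in M then omega z else height X eta z + k.
have o1M z : z \in M -> omega1 z = omega z by rewrite /omega1 => ->.
have -> : kernel (height X eta) (diff_event X M omega) = kernel omega1 (diff_event X M omega).
  apply/esym; apply: (kernel_shift Q tree (k := k)) => z zL; rewrite /omega1.
  case: ifPn => // zM; rewrite -(subrK (omega b) (omega z)) -(heta b z bML (inML _ zL zM)).
  by rewrite /k; ring.
apply: EFin_inj.
rewrite (kernelE tree Q_gt0 U_gt0 K_gt0 nu_prefix).
have -> : extensions omega1 `&` [set sigma | diff_event X M omega (grad tree sigma)] =
    [set omega1].
  apply/seteqP; split => [sigma [so /= hs]|_ ->] /=.
    apply/funext => z; have [zL|zL] := boolP (z \in L); last by rewrite so.
    have [zM _] := sM z zL; have := hs b z bM zM; rewrite !height_grad.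
    rewrite (so b) // (o1M b) // => h.
    by rewrite (o1M z) // -[omega z](subrK (omega b)) -h; ring.
  by split=> // x y xM yM; rewrite !height_grad opprB addrA subrK !o1M.
rewrite esum_set1; last first.
  rewrite lee_fin divr_ge0 // ltW //; first exact: (gibbs_weight_gt0 tree X).
  exact: (partition_gt0 tree Q_gt0 U_gt0 K_gt0 nu_prefix).
congr (_%:E).
rewrite (partitionE tree Q_gt0 U_gt0 K_gt0 nu_prefix _ sM bL bM).
have -> : diff_event X (M `\` L)%fset omega1 = diff_event X (M `\` L)%fset omega.
  apply/seteqP; split => eta' h x y xM yM; rewrite h // !o1M //;
    by move: xM yM; rewrite !inE => /andP[_ ?] /andP[_ ?].
rewrite -(eq_cyl_mass Q U K o1M) -/M.
have w0 : 0 < weight omega1 by exact: (gibbs_weight_gt0 tree X).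
have D0 := nu_outer_gt0 tree Q_gt0 U_gt0 K_gt0 nu_prefix L n omega.
by field; rewrite !gt_eqF.
Qed.

Lemma outer_eventE x y k :
  [set eta : gradient e | exists2 omega, gradient_of omega eta & omega y - omega x = k] =
  [set eta | height X eta y - height X eta x = k].
Proof.
apply/seteqP; split => eta /=.
  by move=> [omega oe <-]; exact: (height_diff tree X).
by move=> h; exists (height X eta) => //; exact: (gradient_of_height tree).
Qed.

(** The events invariant under this equivalence form a sigma-algebra containing the generators; as
    the relation is symmetric, one implication is enough in [inv]. *)
Lemma outer_event_determined (B : set (gradient e)) eta eta' :
  <<s outer_events e L >> B ->
  (forall x y, x \notin L -> y \notin L ->
     height X eta y - height X eta x = height X eta' y - height X eta' x) ->
  B eta <-> B eta'.
Proof.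
move: B eta eta'; pose inv := [set B : set (gradient e) | forall eta eta',
  (forall x y, x \notin L -> y \notin L ->
     height X eta y - height X eta x = height X eta' y - height X eta' x) ->
  B eta -> B eta'].
suff sub : <<s outer_events e L >> `<=` inv.
  move=> B eta eta' /sub h hd; split; apply: h => // x y xL yL; exact/esym/hd.
apply: smallest_sub.
  split.
  - by [].
  - move=> B hB e1 e2 h [_ nB]; split => // /(hB e2 e1) h'; apply: nB; apply: h'.
    by move=> x y xL yL; exact/esym/h.
  - by move=> F hF e1 e2 h [n _ Fn]; exists n => //; exact: (hF n _ _ h).
move=> _ [x [y [k [xL yL ->]]]] e1 e2 h; rewrite outer_eventE /= => <-.
exact/esym/h.
Qed.

Lemma outer_measurable (B : set (gradient e)) :
  <<s outer_events e L >> B -> measurable (B : set (grad_space e)).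
Proof.
move: B; apply: smallest_sub; first exact: sigma_algebra_measurable.
move=> _ [x [y [k [xL yL ->]]]]; rewrite outer_eventE.
have [n /fsubsetP h] := prefix_sup X [fset x; y]%fset.
apply: (@measurable_determined _ _ _ tree X n) => eta eta' /diff_event_prefix hd /= <-.
by apply/esym/hd; apply: h; rewrite !inE eqxx ?orbT.
Qed.

Lemma outer_diff_event (S : {fset V}) omega : (forall x, x \in S -> x \notin L) ->
  <<s outer_events e L >> (diff_event (e := e) X S omega).
Proof.
move=> SL; rewrite (_ : diff_event X S omega = \bigcap_(x in [set` S]) \bigcap_(y in [set` S])
   [set eta : gradient e | height X eta y - height X eta x = omega y - omega x]); last first.
  by apply/seteqP; split => eta h x xL; [move=> y yL; exact: h|move=> y yL; exact: (h x)].
apply: (@fin_bigcap_measurable _ (g_sigma_algebraType (outer_events e L))) => [|x xS].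
  exact: finite_fset.
apply: (@fin_bigcap_measurable _ (g_sigma_algebraType (outer_events e L))) => [|y yS].
  exact: finite_fset.
apply: sub_sigma_algebra; exists x, y, (omega y - omega x); split; try exact: SL.
by rewrite outer_eventE.
Qed.

Let g (A : set (gradient e)) (eta : gradient e) : R := kernel (height X eta) A.

Notation outer_space := (g_sigma_algebraType (outer_events e L)).

Let g_ge0 A eta : 0 <= g A eta.
Proof. exact: (kernel_ge0 tree Q_gt0 U_gt0 K_gt0 nu_prefix). Qed.

Lemma outer_measurable_fun (f : gradient e -> \bar R) :
  measurable_fun [set: outer_space] f -> measurable_fun [set: grad_space e] f.
Proof.
move=> mf _ B mB; apply: outer_measurable; exact: (mf measurableT B mB).
Qed.

(** Measurability and the integral identity are carried together through a pi-lambda argument,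
    started from prefixes long enough to surround [L]. *)
Lemma kernel_spec (A : set (grad_space e)) : measurable A ->
  measurable_fun [set: outer_space] (EFin \o g A) /\
  (\int[nu]_eta (g A eta)%:E = nu A)%E.
Proof.
have [n0 [b [bL sur]]] := ex_surrounds tree X L.
rewrite (measurable_prefix_events tree X n0); move: A.
apply: (dynkin_induction (measurable_prefix_events tree X n0)).
- exact: prefix_events_setI.
- have g1 eta : g setT eta = 1 by exact: (kernelT tree Q_gt0 U_gt0 K_gt0 nu_prefix).
  split.
    by rewrite (_ : _ \o _ = cst 1%E) //; apply/funext => eta; rewrite /= g1.
  under eq_integral do rewrite g1.
  by rewrite integral_cst // mul1e.
- move=> _ [->|[n [omega [nn ->]]]].
    have g0 eta : g set0 eta = 0.
      rewrite /g -(setCT) (kernelC tree Q_gt0 U_gt0 K_gt0 nu_prefix).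
      by rewrite (kernelT tree Q_gt0 U_gt0 K_gt0 nu_prefix) subrr.
    split.
      by rewrite (_ : _ \o _ = cst 0%E) //; apply/funext => eta; rewrite /= g0.
    by under eq_integral do rewrite g0; rewrite integral0 measure0.
  have [sM bM] := sur n nn.
  have gE eta := kernel_prefix omega eta sM bL bM.
  set D := diff_event X (prefix X n `\` L)%fset omega in gE *.
  set k := _ / _ in gE.
  have oD : <<s outer_events e L >> D.
    by apply: outer_diff_event => x; rewrite inE => /andP[].
  have D0 : 0 < fine (nu D) := nu_outer_gt0 tree Q_gt0 U_gt0 K_gt0 nu_prefix L n omega.
  split.
    apply/measurable_EFinP; rewrite (_ : g _ = (fun eta => k * \1_D eta)); last first.
      by apply/funext => eta; rewrite /g gE.
    apply: measurable_funM; first exact: measurable_cst.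
    exact: (@measurable_indic _ outer_space).
  under eq_integral do rewrite /g gE EFinM.
  rewrite ge0_integralZl_EFin //; last 2 first.
  - apply/measurable_EFinP; apply: measurable_indic; exact: outer_measurable.
  - by rewrite divr_ge0 // ltW.
  rewrite integral_indic //; last exact: outer_measurable.
  rewrite setIT nu_prefix -[X in (_ * X)%E]fineK; last first.
    by rewrite fin_num_measure //; exact: outer_measurable.
  by rewrite -EFinM /k divfK // gt_eqF.
- move=> A mA [mgA intA].
  have gC eta : g (~` A) eta = 1 - g A eta.
    exact: (kernelC tree Q_gt0 U_gt0 K_gt0 nu_prefix).
  have mgC : measurable_fun [set: outer_space] (EFin \o g (~` A)).
    apply/measurable_EFinP; rewrite (_ : g _ = (fun eta => 1 - g A eta)).
      by apply: measurable_funB; [exact: measurable_cst|exact/measurable_EFinP].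
    by apply/funext => eta; rewrite gC.
  split => //.
  have : (\int[nu]_eta ((g A eta)%:E + (g (~` A) eta)%:E) = 1)%E.
    under eq_integral do rewrite gC -EFinD addrC subrK.
    rewrite integral_cst // mul1e; exact: probability_setT.
  rewrite ge0_integralD //; try (by move=> *; rewrite lee_fin);
    try exact: outer_measurable_fun.
  rewrite intA probability_setC // => <-.
  by rewrite addeAC subee ?add0e // fin_num_measure.
move=> F mF tF hF.
have gU eta : ((g (\bigcup_n F n) eta)%:E = \sum_(0 <= n <oo) (g (F n) eta)%:E)%E.
  exact: (kernel_bigcup tree Q_gt0 U_gt0 K_gt0 nu_prefix).
split.
  rewrite (_ : _ \o _ = fun eta => (\sum_(0 <= n <oo) (g (F n) eta)%:E)%E).
    apply: (@ge0_emeasurable_sum _ outer_space R setT (fun n eta => (g (F n) eta)%:E) xpredT).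
      by move=> n eta _ _; rewrite lee_fin.
    by move=> n _; exact: (hF n).1.
  by apply/funext => eta; exact: gU.
under eq_integral do rewrite gU.
rewrite integral_nneseries //; first last.
- by move=> n eta _; rewrite lee_fin.
- by move=> n; apply: outer_measurable_fun; exact: (hF n).1.
rewrite measure_semi_bigcup //; last exact: bigcupT_measurable.
by apply: eq_eseriesr => n _; exact: (hF n).2.
Qed.

(** Properness of the kernel: all extensions of a boundary condition share its height differences
    off [L], hence agree on whether [B] holds. *)
Lemma kernel_outer (A B : set (gradient e)) eta : <<s outer_events e L >> B ->
  g (A `&` B) eta = g A eta * \1_B eta.
Proof.
move=> oB; rewrite /g.
have same sigma : extensions (height X eta) sigma ->
    B (grad tree sigma) <-> B eta.
  move=> so; apply: outer_event_determined => // x y xL yL.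
  by rewrite !height_grad (so x xL) (so y yL) opprB addrA subrK.
rewrite indicE; have [/set_mem Beta|nB] := boolP (eta \in B).
  rewrite mulr1; apply: EFin_inj.
  rewrite !(kernelE tree Q_gt0 U_gt0 K_gt0 nu_prefix); congr esum.
  apply/seteqP; split => sigma [so /=]; first by case.
  by move=> As; split => //; split => //; apply/(same sigma so).
rewrite mulr0; apply: EFin_inj.
rewrite !(kernelE tree Q_gt0 U_gt0 K_gt0 nu_prefix) esum1 // => sigma [so /= [_ Bs]].
by exfalso; move: nB; rewrite notin_setE; apply; apply/(same sigma so).
Qed.

(** Properness turns the integral over [B] of the kernel of [A] into the full integral of the kernel
    of [A] intersected with [B], which [kernel_spec] evaluates. *)
Lemma kernel_cond_prob (A : set (grad_space e)) : measurable A ->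
  exists2 f : gradient e -> R,
    forall eta omega, same_outer_differences L eta omega -> f eta = kernel omega A &
    cond_prob nu (outer_events e L) A f.
Proof.
move=> mA; exists (g A).
  move=> eta omega [omega' oe h]; rewrite /g.
  have [n0 [b [bL _]]] := ex_surrounds tree X L.
  apply: (kernel_shift Q tree (k := height X eta b - omega b)) => x xL.
  have := h b x bL xL; rewrite -(height_diff tree X b x oe) => hx.
  by rewrite -[LHS](subrK (height X eta b)) -hx; ring.
have [mg _] := kernel_spec mA.
split.
  move=> B mB; have := (measurable_EFinP _ _).1 mg measurableT B mB.
  by rewrite setTI.
move=> B oB; have mB := outer_measurable oB.
rewrite -(kernel_spec (measurableI _ _ mA mB)).2.
rewrite integral_mkcond; apply: eq_integral => eta _.
rewrite kernel_outer // /patch indicE; case: ifP => _; first by rewrite mulr1.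
by rewrite mulr0.
Qed.

End GibbsProperty.

(** * From the bound on the l_1 norm to the two criteria *)

Lemma nonfree_gradient_gibbs_measure (R : realType) (d q : nat) (Q : int -> R)
    (V : countType) (e : rel V) : (2 <= d)%N -> (2 <= q)%N ->
  summable [set: int] (fun i => (Q i)%:E) -> (forall i, 0 < Q i) ->
  (forall i, Q (- i) = Q i) -> Q 0 = 1 -> cayley_tree e d ->
  rsum [set: int] Q ^+ d.+1 < q%:R ^+ d.-1 ->
  exists (lam : int -> R) (nu : probability (grad_space e) R),
    periodic_boundary_law d Q q lam /\ is_nu d Q q lam nu /\
    aut_invariant nu /\ gradient_gibbs Q nu /\ ~ is_free_state Q nu.
Proof.
move=> d2 q2 Q_l1 Q_gt0 Q_even Q0 tree S_lt; have d0 : (0 < d)%N by exact: ltnW.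
have [U [K [U_gt0 K_gt0 U_eq U_nc]]] :=
  nonconstant_fixed_point q2 d0 Q_l1 Q_gt0 Q_even Q0 S_lt.
have [X] := ex_exhaustion tree.
have [nu nuP] := ex_gradient_measure tree X Q_l1 Q_gt0 Q_even U_gt0 K_gt0 U_eq.
exists (law_of (d := d) U), nu; split; last split; last split; last split.
- exact: (law_of_periodic_boundary_law q2 Q_l1 Q_gt0 U_gt0 K_gt0 U_eq).
- move=> L w zeta cL.
  rewrite (nu_increments tree Q_l1 Q_gt0 Q_even U_gt0 K_gt0 U_eq nuP) //; last first.
    by apply/fset0Pn; exists (val w); exact: valP.
  by rewrite (fuzzy_sum tree d0 Q_l1 Q_gt0 Q_even U_gt0 K_gt0 U_eq w
    (gradient_of_height tree X zeta) cL).
- move=> phi aut A mA; have [[psi phiK psiK] phi_edge] := aut.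
  exact: (nu_relabel tree Q_l1 Q_gt0 Q_even U_gt0 K_gt0 U_eq nuP phiK psiK).
- move=> L A mA; exact: (kernel_cond_prob tree Q_gt0 U_gt0 K_gt0 nuP).
- exact: (nu_not_free tree Q_l1 Q_gt0 Q_even U_gt0 K_gt0 U_eq nuP).
Qed.

Lemma lp_norm1 (R : realType) (S : set int) (Q : int -> R) :
  (forall i, 0 < Q i) -> lp_norm 1 S Q = rsum S Q.
Proof.
move=> Q_gt0; rewrite /lp_norm invr1 powRr1.
  by congr rsum; apply/funext => j; rewrite powRr1 // gtr0_norm.
by apply: fine_ge0; apply: esum_ge0 => j _; rewrite lee_fin powR_ge0.
Qed.

Theorem theorem3 (R : realType) (d : nat) (Q : int -> R) (d_ge2 : (2 <= d)%N)
    (Q_l1 : summable [set: int] (fun i => (Q i)%:E))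
    (Q_gt0 : forall i, 0 < Q i) (Q_even : forall i, Q (- i) = Q i)
    (Q_0 : Q 0 = 1) :
  (good_set d (lp_norm 1 [set: int] Q, lp_norm 1 (~` [set 0]) Q) ->
   forall q : nat, (2 <= q)%N ->
   forall (V : countType) (e : rel V), cayley_tree e d ->
   exists (lam : int -> R) (nu : probability (grad_space e) R),
     periodic_boundary_law d Q q lam /\ is_nu d Q q lam nu /\
     aut_invariant nu /\ gradient_gibbs Q nu /\ ~ is_free_state Q nu)
  /\
  ((\sum_(1 <= i <oo)
      (\sum_(1 <= j <oo) (radial_sup Q (i * j)%N)%:E) `^ (d.+1%:R / 2)
    < +oo)%E ->
   (@good_set R d)° (lp_norm (d.+1%:R / 2) [set: int] Q,
                      lp_norm d.+1%:R (~` [set 0]) Q) ->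
   exists q0 : nat, (2 <= q0)%N /\
   forall q : nat, (q0 <= q)%N ->
   forall (V : countType) (e : rel V), cayley_tree e d ->
   exists (lam : int -> R) (nu : probability (grad_space e) R),
     periodic_boundary_law d Q q lam /\ is_nu d Q q lam nu /\
     aut_invariant nu /\ gradient_gibbs Q nu /\ ~ is_free_state Q nu).
Proof.
split=> [good|_ _].
  move=> q q2 V e tree; apply: nonfree_gradient_gibbs_measure => // {V e tree}.
  move: good => [/=]; rewrite !lp_norm1 // => S1 D0 [eps [eps0 h1 h2]].
  have SD := rsumQ_setD1 Q_l1 Q_gt0; rewrite Q_0 in SD.
  set gam := rsum [set: int] Q in S1 h1 h2 SD *; set del := rsum _ Q in D0 h1 h2 SD.
  case: d d_ge2 h1 h2 => // m m_gt0 h1 h2 /=.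
  (* The bound for [q = 2] implies it for every larger [q]. *)
  apply: lt_le_trans (_ : 2 ^+ m <= _); last first.
    by rewrite lerXn2r ?nnegrE ?ler_nat.
  apply: (good_set_pow_bound m_gt0 S1 eps0); first by lra.
  (* The nonnegative term [2 d del eps ^ d] of the second condition is dropped. *)
  apply: le_lt_trans h2; rewrite /= -mul2n natrM -[m.+1%:R]natr1 lerDl.
  by rewrite !mulr_ge0 ?exprn_ge0 // ltW.
set S := rsum [set: int] Q ^+ d.+1.
have S0 : 0 <= S.
  by rewrite exprn_ge0 // fine_ge0 // esum_ge0 // => i _; rewrite lee_fin ltW.
(* Since [d - 1 >= 1], the criterion [S < q ^ (d - 1)] already follows from [S < q]. *)
exists (maxn 2 (Num.bound S)); split; first exact: leq_maxl.
move=> q; rewrite geq_max => /andP[q2 Sq] V e tree.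
apply: nonfree_gradient_gibbs_measure => //; rewrite -/S.
apply: lt_le_trans (archi_boundP S0) _.
apply: le_trans (_ : q%:R <= _); first by rewrite ler_nat.
case: (d) d_ge2 => [|[|m]] // _ /=.
by rewrite exprS ler_peMr // exprn_ege1 // ler1n ltnW.
Qed.
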